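(* Let $(\mathcal C,\mathbb E,\mathfrak s)$ be an extriangulated category satisfying Condition (WIC), and let $\xi$ be a proper class of $\mathbb E$-triangles such that $\mathcal C$ has enough $\xi$-projectives and enough $\xi$-injectives. Let $M$ be an object of $\mathcal C$ of finite quasi-$\xi$-Gorenstein projective dimension and let $n$ be a positive integer. Then the following are equivalent: (1) $\xi\text{-}\mathcal{QG}\mathrm{pd}(M)\le n$. (2) $\xi\mathrm{xt}_\xi^{\,n+i}(M,Q)=0$ for all $i\ge1$ and all $Q\in\mathcal{QP}(\xi)$. (3) For any integer $i$ with $0\le i\le n$ there exists a $\xi$-exact complex $G_n\to G_{n-1}\to\cdots\to G_1\to G_0\to M$ such that $G_i\in\mathcal{QGP}(\xi)$ and $G_j\in\mathcal P(\xi)$ for all $j\ne i$. Moreover, $$\xi\text{-}\mathcal{QG}\mathrm{pd}(M)=\sup\{m\in\mathbb N\mid \exists\, Q\in\mathcal{QP}(\xi)\text{ such that }\xi\mathrm{xt}_\xi^{\,m}(M,Q)\neq0\}.$$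
   Context: Extriangulated categories (Nakaoka–Palu). $\mathcal C$ is an additive category with a biadditive functor $\mathbb E:\mathcal C^{op}\times\mathcal C\to\mathbf{Ab}$. An element $\delta\in\mathbb E(C,A)$ is an $\mathbb E$-extension; write $a_*\delta=\mathbb E(C,a)(\delta)$ and $c^*\delta=\mathbb E(c,A)(\delta)$. A morphism $(a,c):\delta\to\delta'$ from $\delta\in\mathbb E(C,A)$ to $\delta'\in\mathbb E(C',A')$ is a pair $a:A\to A'$, $c:C\to C'$ with $a_*\delta=c^*\delta'$. Sequences $A\to B\to C$ and $A\to B'\to C$ are equivalent if there is an isomorphism $B\to B'$ compatible with $1_A,1_C$. A realization $\mathfrak s$ assigns to each $\delta\in\mathbb E(C,A)$ an equivalence class $[A\xrightarrow{x}B\xrightarrow{y}C]$ such that every morphism $(a,c)$ of extensions extends to a commutative $(a,b,c)$ between the realizing sequences; it is additive if $\mathfrak s(0)=[A\to A\oplus C\to C]$ and $\mathfrak s(\delta\oplus\delta')=\mathfrak s(\delta)\oplus\mathfrak s(\delta')$. The triple is extriangulated if: (ET1) $\mathbb E$ is biadditive; (ET2) $\mathfrak s$ is an additive realization; (ET3) if $A\xrightarrow{x}B\xrightarrow{y}C$, $A'\xrightarrow{x'}B'\xrightarrow{y'}C'$ realize $\delta,\delta'$ and $bx=x'a$, then there is $c$ with $cy=y'b$ and $a_*\delta=c^*\delta'$; (ET3)$^{op}$ the dual; (ET4) if $A\xrightarrow{f}B\xrightarrow{f'}D$ realizes $\delta$ and $B\xrightarrow{g}C\xrightarrow{g'}F$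 realizes $\delta'$, there are an object $E$, morphisms $h=gf$, $h':C\to E$, $d:D\to E$, $e:E\to F$ with $h'g=df'$, $eh'=g'$, and $\delta''\in\mathbb E(E,A)$ realized by $A\xrightarrow{h}C\xrightarrow{h'}E$, such that $D\xrightarrow{d}E\xrightarrow{e}F$ realizes $f'_*\delta'$, $d^*\delta''=\delta$, $f_*\delta''=e^*\delta'$; (ET4)$^{op}$ the dual. If $A\xrightarrow{x}B\xrightarrow{y}C$ realizes $\delta$, then $x$ is called an inflation, $y$ a deflation, and $A\xrightarrow{x}B\xrightarrow{y}C\overset{\delta}{\dashrightarrow}$ an $\mathbb E$-triangle; it is split if $\delta=0$. Condition (WIC): if $gf$ is an inflation then so is $f$; if $gf$ is a deflation then so is $g$. Proper class. A class $\xi$ of $\mathbb E$-triangles closed under isomorphisms is proper if: (1) it is closed under finite coproducts and contains all split $\mathbb E$-triangles; (2) it is closed under base change (triangles realizing $c^*\delta$) and cobase change (triangles realizing $a_*\delta$); (3) it is saturated: given $\mathbb E$-triangles $A_i\to B_i\xrightarrow{y_i}C\overset{\delta_i}{\dashrightarrow}$ ($i=1,2$), if the second one and the $\mathbb E$-triangle $A_1\to L\to B_2\overset{y_2^*\delta_1}{\dashrightarrow}$ are in $\xi$, then the first one is in $\xi$. $P$ is $\xi$-projective if for each $\mathbb E$-triangle $A\to B\to C\dashrightarrow$ in $\xi$ the sequence $0\to\mathcal C(P,A)\to\mathcal C(P,B)\to\mathcal C(P,C)\to0$ is exact; $\mathcal P(\xi)$ is the class of $\xi$-projectives; $\xi$-injective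 is dual. Enough $\xi$-projectives: for each $A$ there is $K\to P\to A\dashrightarrow$ in $\xi$ with $P\in\mathcal P(\xi)$; enough $\xi$-injectives is dual. $Q$ is quasi-$\xi$-projective ($Q\in\mathcal{QP}(\xi)$) if for each $\mathbb E$-triangle $A\to Q\to B\dashrightarrow$ in $\xi$ the sequence $0\to\mathcal C(Q,A)\to\mathcal C(Q,Q)\to\mathcal C(Q,B)\to0$ is exact. An $\mathbb E$-triangle $A\to B\to C\dashrightarrow$ is $\mathcal C(-,\mathcal{QP}(\xi))$-exact if $0\to\mathcal C(C,Q)\to\mathcal C(B,Q)\to\mathcal C(A,Q)\to0$ is exact for all $Q\in\mathcal{QP}(\xi)$. A complex $\cdots\to X_1\xrightarrow{d_1}X_0\xrightarrow{d_0}X_{-1}\to\cdots$ is $\xi$-exact if for each $n$ there is an $\mathbb E$-triangle $K_{n+1}\xrightarrow{g_n}X_n\xrightarrow{f_n}K_n\dashrightarrow$ in $\xi$ with $d_n=g_{n-1}f_n$ (its $\xi$-resolution $\mathbb E$-triangles); it is $\mathcal C(-,\mathcal{QP}(\xi))$-exact if moreover these $\mathbb E$-triangles are $\mathcal C(-,\mathcal{QP}(\xi))$-exact. A bounded sequence $G_n\to\cdots\to G_0\to M$ is $\xi$-exact if it splices from $\mathbb E$-triangles $K_{j+1}\to G_j\to K_j\dashrightarrow$ in $\xi$, $0\le j\le n-1$, with $K_0=M$, $K_n=G_n$. An object is quasi-$\xi$-Gorenstein projective (in $\mathcal{QGP}(\xi)$) if it is one of the objects $K_n$ for some $\mathcal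 C(-,\mathcal{QP}(\xi))$-exact complex all of whose terms are $\xi$-projective. Cohomology. A $\xi$-projective resolution of $A$ is a $\xi$-exact complex $\cdots\to P_1\to P_0\to A\to0$ with all $P_n\in\mathcal P(\xi)$; $\xi\mathrm{xt}^n_\xi(A,B)$ ($n\ge0$) is the $n$-th cohomology of the complex $\mathcal C(P_0,B)\to\mathcal C(P_1,B)\to\cdots$ (independent of the resolution, and isomorphic to the group computed from a $\xi$-injective coresolution of $B$). Quasi-$\xi$-Gorenstein projective dimension. $\xi\text{-}\mathcal{QG}\mathrm{pd}(0)=-1$; $\xi\text{-}\mathcal{QG}\mathrm{pd}(A)=0$ for nonzero $A\in\mathcal{QGP}(\xi)$; inductively, for $n>0$, $\xi\text{-}\mathcal{QG}\mathrm{pd}(A)\le n$ if there is an $\mathbb E$-triangle $K\to G\to A\dashrightarrow$ in $\xi$ with $G\in\mathcal{QGP}(\xi)$ and $\xi\text{-}\mathcal{QG}\mathrm{pd}(K)\le n-1$. It equals $n$ if it is $\le n$ but not $\le n-1$, and is $\infty$ if no such $n$ exists.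
   Formalization: The supremum formula is stated with sup ∅ = 0 for nonzero M; for M = 0 it is replaced by the assertion that the dimension is −1 and the set is empty, since no single value of sup ∅ makes the formula true in all cases. *)

(* Defs.v *)
From HB Require Import structures.
From mathcomp Require Import all_boot all_order all_algebra boolp.

Set Implicit Arguments.
Unset Strict Implicit.
Unset Printing Implicit Defensive.

Import GRing.Theory.
Local Open Scope ring_scope.

Reserved Notation "g ∘ f" (at level 40, left associativity).

Record additiveCat := AdditiveCat {
  obj :> Type;
  mor : obj -> obj -> zmodType;
  idmor : forall A, mor A A;
  hcomp : forall A B X, mor B X -> mor A B -> mor A X;
  hcompA : forall A B X Y (h : mor X Y) (g : mor B X) (f : mor A B),
    hcomp h (hcomp g f) = hcomp (hcomp h g) f;
  hcomp1m : forall A B (f : mor A B), hcomp (idmor B) f = f;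
  hcompm1 : forall A B (f : mor A B), hcomp f (idmor A) = f;
  hcompDl : forall A B X (g g' : mor B X) (f : mor A B),
    hcomp (g + g') f = hcomp g f + hcomp g' f;
  hcompDr : forall A B X (g : mor B X) (f f' : mor A B),
    hcomp g (f + f') = hcomp g f + hcomp g f';
  zobj : obj;
  from_zobj : forall A (f : mor zobj A), f = 0;
  to_zobj : forall A (f : mor A zobj), f = 0;
  dsum : obj -> obj -> obj;
  in1 : forall A B, mor A (dsum A B);
  in2 : forall A B, mor B (dsum A B);
  pr1 : forall A B, mor (dsum A B) A;
  pr2 : forall A B, mor (dsum A B) B;
  pr1_in1 : forall A B, hcomp (pr1 A B) (in1 A B) = idmor A;
  pr2_in2 : forall A B, hcomp (pr2 A B) (in2 A B) = idmor B;
  pr1_in2 : forall A B, hcomp (pr1 A B) (in2 A B) = 0;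
  pr2_in1 : forall A B, hcomp (pr2 A B) (in1 A B) = 0;
  dsumE : forall A B,
    hcomp (in1 A B) (pr1 A B) + hcomp (in2 A B) (pr2 A B) = idmor (dsum A B)
}.

Arguments mor {_}.
Arguments idmor {_}.
Arguments zobj {_}.
Arguments dsum {_}.
Arguments in1 {_}.
Arguments in2 {_}.
Arguments pr1 {_}.
Arguments pr2 {_}.
Notation "g ∘ f" := (hcomp g f).

Lemma hcomp0m (C : additiveCat) (A B X : C) (f : mor A B) : (0 : mor B X) ∘ f = 0.
Proof. by apply: (addIr (0 ∘ f)); rewrite -hcompDl !add0r. Qed.

Lemma hcompBm (C : additiveCat) (A B X : C) (g g' : mor B X) (f : mor A B) :
  (g - g') ∘ f = g ∘ f - g' ∘ f.
Proof. by apply: (addIr (g' ∘ f)); rewrite -hcompDl !subrK. Qed.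

Definition is_iso (C : additiveCat) (A B : C) (f : mor A B) : Prop :=
  exists g : mor B A, g ∘ f = idmor A /\ f ∘ g = idmor B.

Definition is_zero (C : additiveCat) (A : C) : Prop :=
  (forall (B : C) (f : mor A B), f = 0) /\ (forall (B : C) (f : mor B A), f = 0).

Definition dsum_mor (C : additiveCat) (A A' B B' : C)
    (f : mor A B) (f' : mor A' B') : mor (dsum A A') (dsum B B') :=
  in1 B B' ∘ f ∘ pr1 A A' + in2 B B' ∘ f' ∘ pr2 A A'.

Definition seq_equiv (C : additiveCat) (A X B B' : C)
    (x : mor A B) (y : mor B X) (x' : mor A B') (y' : mor B' X) : Prop :=
  exists b : mor B B', [/\ is_iso b, b ∘ x = x' & y' ∘ b = y].

(** [E X A] is the group of extensions realized by sequences A -> B -> X;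
    [push a] is a_* and [pull c] is c^*. *)
Record biaddFunctor (C : additiveCat) := BiaddFunctor {
  ext :> C -> C -> zmodType;
  push : forall X A A' : C, mor A A' -> ext X A -> ext X A';
  pull : forall X X' A : C, mor X' X -> ext X A -> ext X' A;
  push1 : forall (X A : C) (d : ext X A), push (idmor A) d = d;
  push_comp : forall (X A A' A'' : C) (a' : mor A' A'') (a : mor A A') (d : ext X A),
    push (a' ∘ a) d = push a' (push a d);
  pull1 : forall (X A : C) (d : ext X A), pull (idmor X) d = d;
  pull_comp : forall (X X' X'' A : C) (c : mor X' X) (c' : mor X'' X') (d : ext X A),
    pull (c ∘ c') d = pull c' (pull c d);
  push_pull : forall (X X' A A' : C) (a : mor A A') (c : mor X' X) (d : ext X A),
    push a (pull c d) = pull c (push a d);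
  push_add : forall (X A A' : C) (a : mor A A') (d d' : ext X A),
    push a (d + d') = push a d + push a d';
  pull_add : forall (X X' A : C) (c : mor X' X) (d d' : ext X A),
    pull c (d + d') = pull c d + pull c d';
  add_push : forall (X A A' : C) (a a' : mor A A') (d : ext X A),
    push (a + a') d = push a d + push a' d;
  add_pull : forall (X X' A : C) (c c' : mor X' X) (d : ext X A),
    pull (c + c') d = pull c d + pull c' d
}.

Definition dsum_ext (C : additiveCat) (E : biaddFunctor C) (X A X' A' : C)
    (d : E X A) (d' : E X' A') : E (dsum X X') (dsum A A') :=
  push (in1 A A') (pull (pr1 X X') d) + push (in2 A A') (pull (pr2 X X') d').

(** [s A B X x y d] reads: the sequence A -x-> B -y-> X lies in the class s(d). *)
Definition assignment (C : additiveCat) (E : biaddFunctor C) :=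
  forall A B X : C, mor A B -> mor B X -> E X A -> Prop.

Section ExtriAxs.
Variables (C : additiveCat) (E : biaddFunctor C) (s : assignment E).
Arguments s {A B X}.

Definition assigns_equivalence_classes : Prop :=
  forall (X A : C) (d : E X A), exists (B : C) (x : mor A B) (y : mor B X),
    forall (B' : C) (x' : mor A B') (y' : mor B' X),
      s x' y' d <-> seq_equiv x y x' y'.

Definition is_realization : Prop :=
  assigns_equivalence_classes /\
  forall (A B X A' B' X' : C) (x : mor A B) (y : mor B X) (d : E X A)
      (x' : mor A' B') (y' : mor B' X') (d' : E X' A')
      (a : mor A A') (c : mor X X'),
    s x y d -> s x' y' d' -> push a d = pull c d' ->
    exists b : mor B B', b ∘ x = x' ∘ a /\ c ∘ y = y' ∘ b.

Definition is_additive_realization : Prop :=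
  [/\ is_realization,
      forall A X : C, s (in1 A X) (pr2 A X) (0 : E X A) &
      forall (A B X A' B' X' : C) (x : mor A B) (y : mor B X) (d : E X A)
          (x' : mor A' B') (y' : mor B' X') (d' : E X' A'),
        s x y d -> s x' y' d' ->
        s (dsum_mor x x') (dsum_mor y y') (dsum_ext d d')].

Definition ET3 : Prop :=
  forall (A B X A' B' X' : C) (x : mor A B) (y : mor B X) (d : E X A)
      (x' : mor A' B') (y' : mor B' X') (d' : E X' A')
      (a : mor A A') (b : mor B B'),
    s x y d -> s x' y' d' -> b ∘ x = x' ∘ a ->
    exists c : mor X X', c ∘ y = y' ∘ b /\ push a d = pull c d'.

Definition ET3op : Prop :=
  forall (A B X A' B' X' : C) (x : mor A B) (y : mor B X) (d : E X A)
      (x' : mor A' B') (y' : mor B' X') (d' : E X' A')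
      (b : mor B B') (c : mor X X'),
    s x y d -> s x' y' d' -> c ∘ y = y' ∘ b ->
    exists a : mor A A', b ∘ x = x' ∘ a /\ push a d = pull c d'.

Definition ET4 : Prop :=
  forall (A B D X F : C) (f : mor A B) (f' : mor B D) (dl : E D A)
      (g : mor B X) (g' : mor X F) (dl' : E F B),
    s f f' dl -> s g g' dl' ->
    exists (Y : C) (h' : mor X Y) (d : mor D Y) (e : mor Y F) (dl'' : E Y A),
      s (g ∘ f) h' dl'' /\ h' ∘ g = d ∘ f' /\ e ∘ h' = g' /\
      s d e (push f' dl') /\ pull d dl'' = dl /\ push f dl'' = pull e dl'.

Definition ET4op : Prop :=
  forall (D A B F X : C) (f' : mor D A) (f : mor A B) (dl : E B D)
      (g' : mor F B) (g : mor B X) (dl' : E X F),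
    s f' f dl -> s g' g dl' ->
    exists (Y : C) (h' : mor Y A) (d : mor D Y) (e : mor Y F) (dl'' : E X Y),
      s h' (g ∘ f) dl'' /\ f ∘ h' = g' ∘ e /\ h' ∘ d = f' /\
      s d e (pull g' dl) /\ push e dl'' = dl' /\ pull g dl'' = push d dl.

End ExtriAxs.

Record extriCat := ExtriCat {
  ecat :> additiveCat;
  EE : biaddFunctor ecat;
  (* [triangle x y d] : A -x-> B -y-> X realizes d *)
  triangle : assignment EE;
  triangle_ET2 : is_additive_realization triangle;
  triangle_ET3 : ET3 triangle;
  triangle_ET3op : ET3op triangle;
  triangle_ET4 : ET4 triangle;
  triangle_ET4op : ET4op triangle
}.

Arguments EE {_}.
Arguments triangle {_ A B X}.

Definition inflation (T : extriCat) (A B : T) (x : mor A B) : Prop :=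
  exists (X : T) (y : mor B X) (d : EE X A), triangle x y d.

Definition deflation (T : extriCat) (B X : T) (y : mor B X) : Prop :=
  exists (A : T) (x : mor A B) (d : EE X A), triangle x y d.

Definition WIC (T : extriCat) : Prop :=
  (forall (A B X : T) (f : mor A B) (g : mor B X),
     inflation (g ∘ f) -> inflation f) /\
  (forall (A B X : T) (f : mor A B) (g : mor B X),
     deflation (g ∘ f) -> deflation g).

Record properClass (T : extriCat) := ProperClass {
  in_class : assignment (@EE T);
  in_class_triangle : forall (A B X : T) (x : mor A B) (y : mor B X) (d : EE X A),
    in_class x y d -> triangle x y d;
  in_class_iso : forall (A B X A' B' X' : T)
      (x : mor A B) (y : mor B X) (d : EE X A)
      (x' : mor A' B') (y' : mor B' X') (d' : EE X' A')
      (a : mor A A') (b : mor B B') (c : mor X X'),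
    in_class x y d -> triangle x' y' d' ->
    is_iso a -> is_iso b -> is_iso c ->
    b ∘ x = x' ∘ a -> c ∘ y = y' ∘ b -> push a d = pull c d' ->
    in_class x' y' d';
  (* the empty coproduct is covered by [in_class_split] *)
  in_class_dsum : forall (A B X A' B' X' : T)
      (x : mor A B) (y : mor B X) (d : EE X A)
      (x' : mor A' B') (y' : mor B' X') (d' : EE X' A'),
    in_class x y d -> in_class x' y' d' ->
    in_class (dsum_mor x x') (dsum_mor y y') (dsum_ext d d');
  in_class_split : forall (A B X : T) (x : mor A B) (y : mor B X),
    triangle x y (0 : EE X A) -> in_class x y (0 : EE X A);
  in_class_base_change : forall (A B X B' X' : T)
      (x : mor A B) (y : mor B X) (d : EE X A) (c : mor X' X)
      (x' : mor A B') (y' : mor B' X'),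
    in_class x y d -> triangle x' y' (pull c d) -> in_class x' y' (pull c d);
  in_class_cobase_change : forall (A B X A' B' : T)
      (x : mor A B) (y : mor B X) (d : EE X A) (a : mor A A')
      (x' : mor A' B') (y' : mor B' X),
    in_class x y d -> triangle x' y' (push a d) -> in_class x' y' (push a d);
  in_class_saturated : forall (A1 B1 A2 B2 X L : T)
      (x1 : mor A1 B1) (y1 : mor B1 X) (d1 : EE X A1)
      (x2 : mor A2 B2) (y2 : mor B2 X) (d2 : EE X A2)
      (m : mor A1 L) (e : mor L B2),
    triangle x1 y1 d1 -> in_class x2 y2 d2 -> in_class m e (pull y2 d1) ->
    in_class x1 y1 d1
}.

Arguments in_class {_} _ {A B X}.

Definition short_exact (U V W : zmodType) (f : U -> V) (g : V -> W) : Prop :=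
  [/\ injective f, forall v, g v = 0 <-> (exists u, f u = v) &
      forall w, exists v, g v = w].

(** 0 -> C(P,A) -> C(P,B) -> C(P,X) -> 0 is exact *)
Definition exact_from (C : additiveCat) (P A B X : C) (x : mor A B) (y : mor B X) :=
  short_exact (fun u : mor P A => x ∘ u) (fun v : mor P B => y ∘ v).

(** 0 -> C(X,Q) -> C(B,Q) -> C(A,Q) -> 0 is exact *)
Definition exact_into (C : additiveCat) (Q A B X : C) (x : mor A B) (y : mor B X) :=
  short_exact (fun u : mor X Q => u ∘ y) (fun v : mor B Q => v ∘ x).

Section Classes.
Variables (T : extriCat) (xi : properClass T).

Definition xi_projective (P : T) : Prop :=
  forall (A B X : T) (x : mor A B) (y : mor B X) (d : EE X A),
    in_class xi x y d -> exact_from P x y.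

Definition xi_injective (I : T) : Prop :=
  forall (A B X : T) (x : mor A B) (y : mor B X) (d : EE X A),
    in_class xi x y d -> exact_into I x y.

Definition enough_xi_projectives : Prop :=
  forall A : T, exists (K P : T) (x : mor K P) (y : mor P A) (d : EE A K),
    in_class xi x y d /\ xi_projective P.

Definition enough_xi_injectives : Prop :=
  forall A : T, exists (I K : T) (x : mor A I) (y : mor I K) (d : EE K A),
    in_class xi x y d /\ xi_injective I.

Definition quasi_xi_projective (Q : T) : Prop :=
  forall (A B : T) (x : mor A Q) (y : mor Q B) (d : EE B A),
    in_class xi x y d -> exact_from Q x y.

Definition QP_exact (A B X : T) (x : mor A B) (y : mor B X) : Prop :=
  forall Q : T, quasi_xi_projective Q -> exact_into Q x y.

(** The differential [cd n] is indexed by its target, so that it stands for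
    d_{n+1} : X_{n+1} -> X_n. *)
Record complex := Complex {
  cX : int -> T;
  cd : forall n, mor (cX (n + 1)) (cX n);
  cdd : forall n, cd n ∘ cd (n + 1) = 0
}.

(** A system of resolution triangles K_{n+1} -g_n-> X_n -f_n-> K_n of the
    complex, which witnesses that it is exact for the proper class. *)
Record resolution_triangles (X : complex) := ResolutionTriangles {
  rtK : int -> T;
  rtg : forall n, mor (rtK (n + 1)) (cX X n);
  rtf : forall n, mor (cX X n) (rtK n);
  rtd : forall n, EE (rtK n) (rtK (n + 1));
  rt_in_class : forall n, in_class xi (rtg n) (rtf n) (rtd n);
  rt_cd : forall n, cd X n = rtg n ∘ rtf (n + 1)
}.

Definition quasi_xi_Gorenstein_projective (A : T) : Prop :=
  exists (X : complex) (R : resolution_triangles X),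
    [/\ forall n, xi_projective (cX X n),
        forall n, QP_exact (rtg R n) (rtf R n) &
        exists n, A = rtK R n].

Fixpoint QGpd_le (n : nat) (A : T) : Prop :=
  match n with
  | 0 => is_zero A \/ quasi_xi_Gorenstein_projective A
  | m.+1 => exists (K G : T) (x : mor K G) (y : mor G A) (d : EE A K),
      [/\ in_class xi x y d, quasi_xi_Gorenstein_projective G & QGpd_le m K]
  end.

(** [QGpd_eq A d] : the dimension of [A] is [d], where [None] is infinity;
    [Negz 0] is -1, the dimension of zero objects. *)
Definition QGpd_eq (A : T) (d : option int) : Prop :=
  match d with
  | Some (Posz 0) => ~ is_zero A /\ quasi_xi_Gorenstein_projective A
  | Some (Posz m.+1) => QGpd_le m.+1 A /\ ~ QGpd_le m A
  | Some (Negz m) => m = 0%N /\ is_zero A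
  | None => forall m, ~ QGpd_le m A
  end.

(** The sequence G_n -> ... -> G_0 -> M. Splicing needs G_n = K_n on the left,
    and the differentials are the composites G_{j+1} -> K_{j+1} -> G_j. *)
Definition bounded_xi_exact (n : nat) (G : nat -> T) (M : T) : Prop :=
  exists K : nat -> T,
    [/\ K 0%N = M, K n = G n &
        forall j, (j < n)%N ->
          exists (g : mor (K j.+1) (G j)) (f : mor (G j) (K j)) (d : EE (K j) (K j.+1)),
            in_class xi g f d].

(** The exact complex ... -> P_1 -> P_0 -> A -> 0 is given by its resolution
    triangles K_{n+1} -> P_n -> K_n with K_0 = A. *)
Record proj_resolution (A : T) := ProjResolution {
  resP : nat -> T;
  resK : nat -> T;
  resg : forall n, mor (resK n.+1) (resP n);
  resf : forall n, mor (resP n) (resK n);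
  resd : forall n, EE (resK n) (resK n.+1);
  resK0 : resK 0%N = A;
  res_in_class : forall n, in_class xi (resg n) (resf n) (resd n);
  res_proj : forall n, xi_projective (resP n)
}.

Definition res_diff (A : T) (R : proj_resolution A) (n : nat) :
    mor (resP R n.+1) (resP R n) := resg R n ∘ resf R n.+1.

Lemma enough_proj_resolution :
  enough_xi_projectives -> forall A : T, inhabited (proj_resolution A).
Proof.
move=> enough A.
pose Kp B := projT1 (cid (enough B)).
pose h1 B := cid (projT2 (cid (enough B))).
pose h2 B := cid (projT2 (h1 B)).
pose h3 B := cid (projT2 (h2 B)).
pose h4 B := cid (projT2 (h3 B)).
pose K n := iter n Kp A.
constructor.
apply: (@ProjResolution A (fun n => projT1 (h1 (K n))) K
          (fun n => projT1 (h2 (K n))) (fun n => projT1 (h3 (K n)))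
          (fun n => projT1 (h4 (K n)))) => // n; by case: (projT2 (h4 (K n))).
Qed.

End Classes.

Section Coboundaries.
Variables (T : extriCat) (xi : properClass T) (A : T) (P : proj_resolution xi A) (B : T).

(** The image of C(P_{n-1}, B), which is zero for n = 0. *)
Definition is_coboundary (n : nat) : mor (resP P n) B -> Prop :=
  match n return mor (resP P n) B -> Prop with
  | 0 => fun u => u = 0
  | m.+1 => fun u => exists v : mor (resP P m) B, u = v ∘ res_diff P m
  end.

Lemma is_coboundary0 n : is_coboundary (0 : mor (resP P n) B).
Proof. by case: n => //= n; exists 0; rewrite hcomp0m. Qed.

Lemma is_coboundaryB n (u v : mor (resP P n) B) :
  is_coboundary u -> is_coboundary v -> is_coboundary (u - v).
Proof.
case: n u v => [|n] u v /=; first by move=> -> ->; rewrite subr0.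
by move=> [u' ->] [v' ->]; exists (u' - v'); rewrite hcompBm.
Qed.

End Coboundaries.

Section CohomologyGroup.
Variables (T : extriCat) (xi : properClass T) (A : T) (P : proj_resolution xi A).
Variables (B : T) (n : nat).

Definition cocycle : pred (mor (resP P n) B) := fun u => u ∘ res_diff P n == 0.

Lemma cocycle_zmod_closed : zmod_closed cocycle.
Proof.
split=> [|u v]; rewrite !unfold_in ?hcomp0m // => /eqP u0 /eqP v0.
by rewrite hcompBm u0 v0 subr0.
Qed.

HB.instance Definition _ :=
  GRing.isZmodClosed.Build (mor (resP P n) B) cocycle cocycle_zmod_closed.

Record cocycles := Cocycles { cocycle_val :> mor (resP P n) B; _ : cocycle_val \in cocycle }.

HB.instance Definition _ := [isSub for cocycle_val].
HB.instance Definition _ := [Choice of cocycles by <:].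
HB.instance Definition _ := [SubChoice_isSubZmodule of cocycles by <:].

Definition coboundary : pred cocycles := fun u => `[< is_coboundary (val u) >].

Lemma coboundary_zmod_closed : zmod_closed coboundary.
Proof.
split=> [|u v]; rewrite !unfold_in /coboundary.
  by apply/asboolP; rewrite raddf0; apply: is_coboundary0.
by move=> /asboolP hu /asboolP hv; apply/asboolP; rewrite raddfB; apply: is_coboundaryB.
Qed.

HB.instance Definition _ :=
  GRing.isZmodClosed.Build cocycles coboundary coboundary_zmod_closed.

Definition xxt : zmodType := Quotient.quot (GRing.ZmodClosed.clone cocycles coboundary _).

End CohomologyGroup.

Arguments xxt {T xi A} P B n.

Definition trivial_group (V : zmodType) : Prop := forall v : V, v = 0.

(** Supremum of a set of natural numbers in N together with infinity ([None]);
    the supremum of the empty set is 0. *)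
Definition is_sup (S : nat -> Prop) (d : option nat) : Prop :=
  match d with
  | Some b => (forall m, S m -> (m <= b)%N) /\
              (forall b', (forall m, S m -> (m <= b')%N) -> (b <= b')%N)
  | None => forall b, exists m, S m /\ (b < m)%N
  end.

(* Main.v *)
(** Relative to the proper class, extensions again satisfy the extriangulated axioms
    (saturation gives closure of inflations and deflations under composition), and
    pushouts and pullbacks of triangles exist. A quasi-Gorenstein projective object
    is one belonging to a class of objects [A] that have a syzygy and a cosyzygy in
    the class and are such that every triangle of [xi] ending in [A] is exact under
    [C(-, QP)]. This coinductive description shows that these objects are closed
    under extensions, then under syzygies and kernels of deflations. Hence the
    [n]-th syzygy of an object of dimension at most [n] is quasi-Gorenstein projective
    in every projective resolution, which yields the vanishing of cohomology, and
    the resolutions in (3) come from Auslander-Buchweitz approximations. Conversely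
    one descends along the resolution: if [K_(j+1)] embeds in a projective [Q] with
    quasi-Gorenstein projective cokernel, vanishing of the [(j+1)]-st cohomology with
    values in [Q] makes [K_j] a complement of [Q] in a quasi-Gorenstein projective. *)
Require Import Defs.
From mathcomp Require Import all_boot all_order all_algebra.
From mathcomp Require Import boolp.

(** * Zero and subtraction for composition and for the two actions on extensions *)

Section Additive.
Set Implicit Arguments.
Unset Strict Implicit.
Import GRing.Theory.
Local Open Scope ring_scope.
Variable C : additiveCat.

Lemma hcompm0 (A B X : C) (g : mor B X) : g ∘ (0 : mor A B) = 0.
Proof. by apply: (addIr (g ∘ 0)); rewrite -hcompDr !add0r. Qed.

Lemma hcompmB (A B X : C) (g : mor B X) (f f' : mor A B) :
  g ∘ (f - f') = g ∘ f - g ∘ f'.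
Proof. by apply: (addIr (g ∘ f')); rewrite -hcompDr !subrK. Qed.

Lemma is_iso_two_sided (A B : C) (f : mor A B) (g h : mor B A) :
  g ∘ f = idmor A -> f ∘ h = idmor B -> is_iso f.
Proof.
move=> gf fh; exists g; split=> //.
by rewrite -[g]hcompm1 -fh (hcompA g) gf hcomp1m.
Qed.

Lemma is_iso_id (A : C) : is_iso (idmor A).
Proof. by exists (idmor A); rewrite hcomp1m. Qed.

Lemma split_epi_cancel (A B X : C) (y : mor A B) (s : mor B A) (u v : mor B X) :
  y ∘ s = idmor B -> u ∘ y = v ∘ y -> u = v.
Proof. by move=> ys uv; rewrite -(hcompm1 u) -(hcompm1 v) -ys !hcompA uv. Qed.

Lemma split_mono_cancel (A B X : C) (x : mor A B) (r : mor B A) (u v : mor X A) :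
  r ∘ x = idmor A -> x ∘ u = x ∘ v -> u = v.
Proof. by move=> rx uv; rewrite -(hcomp1m u) -(hcomp1m v) -rx -!hcompA uv. Qed.

Variable E : biaddFunctor C.

Lemma push0 (X A A' : C) (a : mor A A') : push a (0 : E X A) = 0.
Proof. by apply: (addIr (push a 0)); rewrite -push_add !add0r. Qed.

Lemma pull0 (X X' A : C) (c : mor X' X) : pull c (0 : E X A) = 0.
Proof. by apply: (addIr (pull c 0)); rewrite -pull_add !add0r. Qed.

Lemma push0m (X A A' : C) (d : E X A) : push (0 : mor A A') d = 0.
Proof. by apply: (addIr (push 0 d)); rewrite -add_push !add0r. Qed.

Lemma pull0m (X X' A : C) (d : E X A) : pull (0 : mor X' X) d = 0.
Proof. by apply: (addIr (pull 0 d)); rewrite -add_pull !add0r. Qed.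

Lemma pushB (X A A' : C) (a : mor A A') (d d' : E X A) :
  push a (d - d') = push a d - push a d'.
Proof. by apply: (addIr (push a d')); rewrite -push_add !subrK. Qed.

Lemma pullB (X X' A : C) (c : mor X' X) (d d' : E X A) :
  pull c (d - d') = pull c d - pull c d'.
Proof. by apply: (addIr (pull c d')); rewrite -pull_add !subrK. Qed.

Lemma subr_push (X A A' : C) (a a' : mor A A') (d : E X A) :
  push (a - a') d = push a d - push a' d.
Proof. by apply: (addIr (push a' d)); rewrite -add_push !subrK. Qed.

Lemma subr_pull (X X' A : C) (c c' : mor X' X) (d : E X A) :
  pull (c - c') d = pull c d - pull c' d.
Proof. by apply: (addIr (pull c' d)); rewrite -add_pull !subrK. Qed.

End Additive.

(** * Realizations and split triangles *)

Section Extriangulated.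
Set Implicit Arguments.
Unset Strict Implicit.
Import GRing.Theory.
Local Open Scope ring_scope.
Variable T : extriCat.

Lemma realization_exists (X A : T) (d : EE X A) :
  exists (B : T) (x : mor A B) (y : mor B X), triangle x y d.
Proof.
have [[classes _] _ _] := triangle_ET2 T.
have [B [x [y h]]] := classes X A d; exists B, x, y; apply/h.
by exists (idmor B); rewrite hcomp1m hcompm1; split=> //; apply: is_iso_id.
Qed.

Lemma seq_equiv_sym (A X B B' : T) (x : mor A B) (y : mor B X)
    (x' : mor A B') (y' : mor B' X) :
  seq_equiv x y x' y' -> seq_equiv x' y' x y.
Proof.
case=> b [[c [cb bc]] <- <-]; exists c; split; first by exists b.
  by rewrite hcompA cb hcomp1m.
by rewrite -hcompA bc hcompm1.
Qed.

Lemma seq_equiv_trans (A X B B' B'' : T) (x : mor A B) (y : mor B X)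
    (x' : mor A B') (y' : mor B' X) (x'' : mor A B'') (y'' : mor B'' X) :
  seq_equiv x y x' y' -> seq_equiv x' y' x'' y'' -> seq_equiv x y x'' y''.
Proof.
case=> b [[c [cb bc]] <- <-] [b' [[c' [cb' bc']] <- <-]].
exists (b' ∘ b); split; last by rewrite hcompA.
  exists (c ∘ c'); split.
    by rewrite hcompA -(hcompA c) cb' hcompm1.
  by rewrite hcompA -(hcompA b') bc hcompm1.
by rewrite hcompA.
Qed.

Lemma triangle_seq_equiv (A B X B' : T) (x : mor A B) (y : mor B X)
    (x' : mor A B') (y' : mor B' X) (d : EE X A) :
  triangle x y d -> triangle x' y' d <-> seq_equiv x y x' y'.
Proof.
have [[classes _] _ _] := triangle_ET2 T.
have [B0 [x0 [y0 h]]] := classes X A d => /h e; split=> [/h e'|e'].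
  exact: seq_equiv_trans (seq_equiv_sym e) e'.
by apply/h; apply: seq_equiv_trans e e'.
Qed.

Lemma triangle_lift (A B X A' B' X' : T) (x : mor A B) (y : mor B X) (d : EE X A)
    (x' : mor A' B') (y' : mor B' X') (d' : EE X' A') (a : mor A A') (c : mor X X') :
  triangle x y d -> triangle x' y' d' -> push a d = pull c d' ->
  exists b : mor B B', b ∘ x = x' ∘ a /\ c ∘ y = y' ∘ b.
Proof. by have [[_ h] _ _] := triangle_ET2 T; apply: h. Qed.

Lemma triangle_split (A X : T) : triangle (in1 A X) (pr2 A X) (0 : EE X A).
Proof. by have [_ h _] := triangle_ET2 T; apply: h. Qed.

(** The maps [x ∘ pr1 + s ∘ pr2] and [in1 ∘ r + in2 ∘ y] are mutually inverse, so the sequence is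
    equivalent to the canonical split one. *)
Lemma triangle_biproduct (A B X : T) (x : mor A B) (y : mor B X)
    (r : mor B A) (s : mor X B) :
  r ∘ x = idmor A -> y ∘ s = idmor X -> y ∘ x = 0 -> r ∘ s = 0 ->
  x ∘ r + s ∘ y = idmor B -> triangle x y (0 : EE X A).
Proof.
move=> rx ys yx rs xrsy; apply/(triangle_seq_equiv _ _ (triangle_split A X)).
exists (x ∘ pr1 A X + s ∘ pr2 A X); split.
- pose b := in1 A X ∘ r + in2 A X ∘ y; apply: (@is_iso_two_sided _ _ _ _ b b).
    rewrite hcompDl !hcompDr !hcompA -(hcompA _ r x) -(hcompA _ r s) -(hcompA _ y x).
    by rewrite -(hcompA _ y s) rx rs yx ys !hcompm1 !hcompm0 !hcomp0m addr0 add0r dsumE.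
  rewrite hcompDl !hcompDr !hcompA -!(hcompA x) -!(hcompA s).
  by rewrite pr1_in1 pr1_in2 pr2_in1 pr2_in2 !hcomp1m !hcomp0m !hcompm0 addr0 add0r.
- by rewrite hcompDl -!hcompA pr1_in1 pr2_in1 hcompm0 hcompm1 addr0.
- by rewrite hcompDr !hcompA yx ys hcomp0m hcomp1m add0r.
Qed.

(** * Exactness properties of a single triangle *)

Section TriangleExactness.
Variables (A B X : T) (x : mor A B) (y : mor B X) (d : EE X A).
Hypothesis tri : triangle x y d.

Lemma triangle_comp0 : y ∘ x = 0.
Proof.
have e : x ∘ pr1 A zobj ∘ in1 A zobj = x ∘ idmor A by rewrite -hcompA pr1_in1.
have [c [h _]] := triangle_ET3 (triangle_split A zobj) tri e.
by rewrite -[x]hcompm1 -e hcompA -h -hcompA pr2_in1 hcompm0.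
Qed.

Lemma triangle_push0 : push x d = 0.
Proof.
have [|c [_ ->]] := triangle_ET3 tri (triangle_split B zobj) (a := x) (b := in1 B zobj).
  by [].
exact: pull0.
Qed.

Lemma triangle_pull0 : pull y d = 0.
Proof.
have e : y ∘ pr2 zobj B = y ∘ pr2 zobj B by [].
have [a [_ <-]] := triangle_ET3op (triangle_split zobj B) tri e.
exact: push0.
Qed.

(** By (ET3)op, [v] is part of a morphism from the split triangle with ends [W] and [zobj]; its
    first component is [u]. *)
Lemma triangle_ker (W : T) (v : mor W B) : y ∘ v = 0 -> exists u, v = x ∘ u.
Proof.
move=> yv; have e : 0 ∘ pr2 W zobj = y ∘ (v ∘ pr1 W zobj) by rewrite hcompA yv !hcomp0m.
have [a [h _]] := triangle_ET3op (triangle_split W zobj) tri e.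
by exists a; rewrite -h -hcompA pr1_in1 hcompm1.
Qed.

Lemma triangle_coker (W : T) (w : mor B W) : w ∘ x = 0 -> exists u, w = u ∘ y.
Proof.
move=> wx; have e : (in2 zobj W ∘ w) ∘ x = in1 zobj W ∘ 0.
  by rewrite -hcompA wx !hcompm0.
have [c [h _]] := triangle_ET3 tri (triangle_split zobj W) e.
by exists c; rewrite h hcompA pr2_in2 hcomp1m.
Qed.

Lemma pull_eq0_lift (W : T) (c : mor W X) : pull c d = 0 -> exists b, c = y ∘ b.
Proof.
move=> e; have {}e : push (idmor A) 0 = pull c d by rewrite push1.
have [b [_ h]] := triangle_lift (triangle_split A W) tri e.
by exists (b ∘ in2 A W); rewrite hcompA -h -hcompA pr2_in2 hcompm1.
Qed.

Lemma push_eq0_extend (W : T) (a : mor A W) : push a d = 0 -> exists b, a = b ∘ x.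
Proof.
move=> e; have {}e : push a d = pull (idmor X) 0 by rewrite pull1.
have [b [h _]] := triangle_lift tri (triangle_split W X) e.
by exists (pr1 W X ∘ b); rewrite -hcompA h hcompA pr1_in1 hcomp1m.
Qed.

(** Since [push x d'] splits, [x] extends along the inflation realizing [d'], and (ET3) completes
    this extension to a morphism of triangles. *)
Lemma push_ker (W : T) (d' : EE W A) : push x d' = 0 -> exists c, d' = pull c d.
Proof.
move=> e; have [B' [x' [y' t']]] := realization_exists d'.
have [b h] : exists b, x = b ∘ x'.
  have {}e : push x d' = pull (idmor W) 0 by rewrite pull1.
  have [b [h _]] := triangle_lift t' (triangle_split B W) e.
  by exists (pr1 B W ∘ b); rewrite -hcompA h hcompA pr1_in1 hcomp1m.
have {}h : b ∘ x' = x ∘ idmor A by rewrite hcompm1.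
by have [c [_ dc]] := triangle_ET3 t' tri h; exists c; rewrite -dc push1.
Qed.

Lemma pull_ker (W : T) (d' : EE X W) : pull y d' = 0 -> exists a, d' = push a d.
Proof.
move=> e; have [B' [x' [y' t']]] := realization_exists d'.
have [b h] : exists b, y = y' ∘ b.
  have {}e : push (idmor W) 0 = pull y d' by rewrite push1.
  have [b [_ h]] := triangle_lift (triangle_split W B) t' e.
  by exists (b ∘ in2 W B); rewrite hcompA -h -hcompA pr2_in2 hcompm1.
have {}h : idmor X ∘ y = y' ∘ b by rewrite hcomp1m.
by have [a [_ da]] := triangle_ET3op tri t' h; exists a; rewrite da pull1.
Qed.

Lemma triangle_section (s : mor X B) : y ∘ s = idmor X -> d = 0.
Proof. by move=> ys; rewrite -(pull1 d) -ys pull_comp triangle_pull0 pull0. Qed.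

End TriangleExactness.

(** * Splittings and transport along isomorphisms of the ends *)

Lemma split_triangle_of_retraction (A B X : T) (x : mor A B) (y : mor B X) (r : mor B A) :
  triangle x y (0 : EE X A) -> r ∘ x = idmor A ->
  exists s : mor X B, [/\ triangle s r (0 : EE A X), y ∘ s = idmor X &
    x ∘ r + s ∘ y = idmor B].
Proof.
move=> tri rx.
(* [s'] serves only to cancel [y] on the right; the section adapted to [r] comes from factoring
   [idmor B - x ∘ r] through [y]. *)
have [s' ys'] := pull_eq0_lift tri (c := idmor X) (pull0 _ _ _).
have [|s hs] := triangle_coker tri (w := idmor B - x ∘ r).
  by rewrite hcompBm hcomp1m -hcompA rx hcompm1 subrr.
have yx := triangle_comp0 tri.
have ys : y ∘ s = idmor X.
  apply: (split_epi_cancel (esym ys')).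
  by rewrite -hcompA -hs hcompmB hcompA yx hcomp0m subr0 hcompm1 hcomp1m.
have rs : r ∘ s = 0.
  apply: (split_epi_cancel (esym ys')).
  by rewrite -hcompA -hs hcompmB hcompA rx hcomp1m hcompm1 subrr hcomp0m.
exists s; split=> //; last by rewrite -hs addrC subrK.
by apply: (triangle_biproduct (r := y) (s := x)) => //; rewrite -hs subrK.
Qed.

Lemma split_triangle_of_section (A B X : T) (x : mor A B) (y : mor B X) (s : mor X B) :
  triangle x y (0 : EE X A) -> y ∘ s = idmor X ->
  exists r : mor B A, [/\ triangle s r (0 : EE A X), r ∘ x = idmor A &
    x ∘ r + s ∘ y = idmor B].
Proof.
move=> tri ys.
have [r' r'x] := push_eq0_extend tri (a := idmor A) (push0 _ _ _).
have [|r hr] := triangle_ker tri (v := idmor B - s ∘ y).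
  by rewrite hcompmB hcompm1 hcompA ys hcomp1m subrr.
have yx := triangle_comp0 tri.
have rx : r ∘ x = idmor A.
  apply: (split_mono_cancel (esym r'x)).
  by rewrite hcompA -hr hcompBm -hcompA yx hcompm0 subr0 hcompm1 hcomp1m.
have rs : r ∘ s = 0.
  apply: (split_mono_cancel (esym r'x)).
  by rewrite hcompA -hr hcompBm -hcompA ys hcomp1m hcompm1 subrr hcompm0.
exists r; split=> //; last by rewrite -hr subrK.
by apply: (triangle_biproduct (r := y) (s := x)) => //; rewrite -hr addrC subrK.
Qed.

Lemma triangle_iso_left (A A' B X : T) (x : mor A B) (y : mor B X) (d : EE X A)
    (i : mor A A') (j : mor A' A) :
  triangle x y d -> j ∘ i = idmor A -> i ∘ j = idmor A' ->
  triangle (x ∘ j) y (push i d).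
Proof.
move=> tri ji ij; have [B' [x' [y' tri']]] := realization_exists (push i d).
apply/(triangle_seq_equiv _ _ tri'); apply: seq_equiv_sym.
have e : push i d = pull (idmor X) (push i d) by rewrite pull1.
have e' : push j (push i d) = pull (idmor X) d by rewrite pull1 -push_comp ji push1.
have [b [bx yb]] := triangle_lift tri tri' e.
have [b' [b'x yb']] := triangle_lift tri' tri e'.
rewrite !hcomp1m in yb yb'.
exists b; split=> //; last by rewrite hcompA bx -hcompA ij hcompm1.
(* [b'] need not invert [b], but [idmor B - b' ∘ b] factors through [y = y' ∘ b], so a corrected
   [b'] is a left inverse. A right inverse arises dually. *)
have [g gy] : exists g, g ∘ b = idmor B.
  have [|u hu] := triangle_coker tri (w := idmor B - b' ∘ b).
    by rewrite hcompBm hcomp1m -hcompA bx hcompA b'x -hcompA ji hcompm1 subrr.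
  by exists (u ∘ y' + b'); rewrite hcompDl -hcompA -yb -hu subrK.
have [h bh] : exists h, b ∘ h = idmor B'.
  have [|u hu] := triangle_ker tri' (v := idmor B' - b ∘ b').
    by rewrite hcompmB hcompm1 hcompA -yb -yb' subrr.
  exists (x ∘ j ∘ u + b'); rewrite hcompDr !hcompA bx -(hcompA x') ij hcompm1.
  by rewrite -hu subrK.
exact: is_iso_two_sided gy bh.
Qed.

Lemma triangle_iso_right (A B X X' : T) (x : mor A B) (y : mor B X) (d : EE X A)
    (i : mor X X') (j : mor X' X) :
  triangle x y d -> j ∘ i = idmor X -> i ∘ j = idmor X' ->
  triangle x (i ∘ y) (pull j d).
Proof.
move=> tri ji ij; have [B' [x' [y' tri']]] := realization_exists (pull j d).
apply/(triangle_seq_equiv _ _ tri').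
have e : push (idmor A) (pull j d) = pull j d by rewrite push1.
have e' : push (idmor A) d = pull i (pull j d) by rewrite push1 -pull_comp ji pull1.
have [b [bx yb]] := triangle_lift tri' tri e.
have [b' [b'x yb']] := triangle_lift tri tri' e'.
rewrite !hcompm1 in bx b'x.
exists b; split=> //; last by rewrite -hcompA -yb hcompA ij hcomp1m.
have [g gy] : exists g, g ∘ b = idmor B'.
  have [|u hu] := triangle_coker tri' (w := idmor B' - b' ∘ b).
    by rewrite hcompBm hcomp1m -hcompA bx b'x subrr.
  exists (u ∘ i ∘ y + b'); rewrite hcompDl -!hcompA -yb (hcompA i) ij hcomp1m.
  by rewrite -hu subrK.
have [h bh] : exists h, b ∘ h = idmor B.
  have [|u hu] := triangle_ker tri (v := idmor B - b ∘ b').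
    by rewrite hcompmB hcompm1 hcompA -yb -hcompA -yb' hcompA ji hcomp1m subrr.
  by exists (x' ∘ u + b'); rewrite hcompDr !hcompA bx -hu subrK.
exact: is_iso_two_sided gy bh.
Qed.

Lemma triangle_pushout (A B X B1 X1 : T) (x : mor A B) (y : mor B X) (d : EE X A)
    (x1 : mor A B1) (y1 : mor B1 X1) (d1 : EE X1 A) :
  triangle x y d -> triangle x1 y1 d1 ->
  exists (L : T) (m : mor B1 L) (e : mor L X) (m1 : mor B L) (e1 : mor L X1),
    triangle m e (push x1 d) /\ triangle m1 e1 (push x d1).
Proof.
move=> tri tri1.
have [L [m1 [e1 triL]]] := realization_exists (push x d1).
have [Y [h [a [e' [d'' [tri'' [_ [_ [triY [ad'' xd'']]]]]]]]]] := triangle_ET4 tri triL.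
rewrite -push_comp (triangle_comp0 tri) push0m in triY.
have [s0 /esym es0] := pull_eq0_lift triY (c := idmor X1) (pull0 _ _ _).
(* An arbitrary section [s0] pulls [d''] back to [d1] only up to a pullback of [d]; subtracting
   [a ∘ t] removes the error. *)
have [t ht] : exists t, pull s0 d'' - d1 = pull t d.
  apply: (push_ker tri); rewrite pushB push_pull xd'' -pull_comp es0 pull1.
  exact: subrr.
pose s := s0 - a ∘ t.
have es : e' ∘ s = idmor X1.
  by rewrite hcompmB hcompA (triangle_comp0 triY) hcomp0m subr0.
have sd : pull s d'' = d1.
  by rewrite subr_pull pull_comp ad'' -ht opprB addrC subrK.
have [r [trir ra _]] := split_triangle_of_section triY es.
have [Y' [m [f [q [d3 [tri3 [_ [_ [triY' [qd3 rd3]]]]]]]]]] := triangle_ET4op tri'' trir.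
rewrite sd in triY'.
have /(triangle_seq_equiv _ _ tri1) [b [[c [cb bc]] bx1 _]] := triY'.
exists L, (m ∘ b), (r ∘ h), m1, e1; split=> //.
have -> : push x1 d = push c d3.
  have -> : x1 = c ∘ f by rewrite -bx1 hcompA cb hcomp1m.
  by rewrite push_comp -ad'' push_pull -rd3 -pull_comp ra pull1.
exact: triangle_iso_left.
Qed.

Lemma triangle_pullback (A B X A1 B1 : T) (x : mor A B) (y : mor B X) (d : EE X A)
    (x1 : mor A1 B1) (y1 : mor B1 X) (d1 : EE X A1) :
  triangle x y d -> triangle x1 y1 d1 ->
  exists (L : T) (m : mor A L) (e : mor L B1) (m1 : mor A1 L) (e1 : mor L B),
    triangle m e (pull y1 d) /\ triangle m1 e1 (pull y d1).
Proof.
move=> tri tri1.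
have [L [m1 [e1 triL]]] := realization_exists (pull y d1).
have [Y [h [a [e' [d'' [tri'' [_ [_ [triY [ed'' yd'']]]]]]]]]] := triangle_ET4op triL tri.
rewrite -pull_comp (triangle_comp0 tri) pull0m in triY.
have [r0 /esym ra0] := push_eq0_extend triY (a := idmor A1) (push0 _ _ _).
have [t ht] : exists t, push r0 d'' - d1 = push t d.
  apply: (pull_ker tri); rewrite pullB -push_pull yd'' -push_comp ra0 push1.
  exact: subrr.
pose r := r0 - t ∘ e'.
have ra : r ∘ a = idmor A1.
  by rewrite hcompBm -hcompA (triangle_comp0 triY) hcompm0 subr0.
have rd : push r d'' = d1.
  by rewrite subr_push push_comp ed'' -ht opprB addrC subrK.
have [s [tris es _]] := split_triangle_of_retraction triY ra.
have [Y' [g [p [q [d3 [tri3 [_ [_ [triY' [pd3 sd3]]]]]]]]]] := triangle_ET4 tris tri''.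
rewrite rd in triY'.
have /(triangle_seq_equiv _ _ tri1) [b [[c [cb bc]] _ qb]] := triY'.
exists L, (h ∘ s), (c ∘ g), m1, e1; split=> //.
have -> : pull y1 d = pull b d3.
  by rewrite -qb pull_comp -ed'' -push_pull -sd3 -push_comp es push1.
exact: triangle_iso_right.
Qed.

End Extriangulated.

(** * Extensions relative to the proper class *)

Section ProperClass.
Set Implicit Arguments.
Unset Strict Implicit.
Import GRing.Theory.
Local Open Scope ring_scope.
Variables (T : extriCat) (xi : properClass T).

Definition xi_extension (X A : T) (d : EE X A) : Prop :=
  exists (B : T) (x : mor A B) (y : mor B X), in_class xi x y d.

(** Base change along the identity passes from one realization of [d] to any other, so membership
    depends on the extension alone. *)
Lemma xi_extension_in_class (A B X : T) (x : mor A B) (y : mor B X) (d : EE X A) :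
  xi_extension d -> triangle x y d -> in_class xi x y d.
Proof.
case=> B' [x' [y' h]] tri; rewrite -(pull1 d).
by apply: (in_class_base_change h); rewrite pull1.
Qed.

Lemma in_class_xi_extension (A B X : T) (x : mor A B) (y : mor B X) (d : EE X A) :
  in_class xi x y d -> xi_extension d.
Proof. by exists B, x, y. Qed.

Lemma xi_extension_push (X A A' : T) (a : mor A A') (d : EE X A) :
  xi_extension d -> xi_extension (push a d).
Proof.
case=> B [x [y h]]; have [B' [x' [y' tri]]] := realization_exists (push a d).
by exists B', x', y'; apply: in_class_cobase_change h tri.
Qed.

Lemma xi_extension_pull (X X' A : T) (c : mor X' X) (d : EE X A) :
  xi_extension d -> xi_extension (pull c d).
Proof.
case=> B [x [y h]]; have [B' [x' [y' tri]]] := realization_exists (pull c d).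
by exists B', x', y'; apply: in_class_base_change h tri.
Qed.

Lemma xi_extension_saturated (A B X A' : T) (x : mor A B) (y : mor B X) (d : EE X A)
    (d' : EE X A') :
  in_class xi x y d -> xi_extension (pull y d') -> xi_extension d'.
Proof.
move=> h [L [m [e hL]]]; have [B' [x' [y' tri]]] := realization_exists d'.
by exists B', x', y'; apply: in_class_saturated tri h hL.
Qed.

Lemma in_class_comp_inflation (A B D X F : T)
    (f : mor A B) (f' : mor B D) (d : EE D A)
    (g : mor B X) (g' : mor X F) (d' : EE F B) :
  in_class xi f f' d -> in_class xi g g' d' ->
  exists (Y : T) (h : mor X Y) (d1 : EE Y A) (u : mor D Y) (v : mor Y F) (d2 : EE F D),
    in_class xi (g ∘ f) h d1 /\ in_class xi u v d2.
Proof.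
move=> hf hg; have [trif trig] := (in_class_triangle hf, in_class_triangle hg).
have [Y [h [u [v [d1 [tri1 [_ [_ [tri2 [_ fd1]]]]]]]]]] := triangle_ET4 trif trig.
exists Y, h, d1, u, v, (push f' d'); split; last first.
  exact: in_class_cobase_change hg tri2.
apply: xi_extension_in_class tri1.
(* Saturation is applied to the deflation l realizing v^* d': the pullback l^* d1 is
   killed by f_*, hence is a pullback of d. *)
have [L [m [l hL]]] := xi_extension_pull v (in_class_xi_extension hg).
apply: (xi_extension_saturated hL).
have [k ->] : exists k, pull l d1 = pull k d.
  apply: (push_ker trif).
  by rewrite push_pull fd1 (triangle_pull0 (in_class_triangle hL)).
exact: xi_extension_pull (in_class_xi_extension hf).
Qed.

(** Saturation applies along [g] itself, since the pullback of [d1] along [g] is a pushout of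
    [d]. *)
Lemma in_class_comp_deflation (D A B F X : T)
    (f' : mor D A) (f : mor A B) (d : EE B D)
    (g' : mor F B) (g : mor B X) (d' : EE X F) :
  in_class xi f' f d -> in_class xi g' g d' ->
  exists (Y : T) (h : mor Y A) (d1 : EE X Y) (u : mor D Y) (v : mor Y F) (d2 : EE F D),
    in_class xi h (g ∘ f) d1 /\ in_class xi u v d2.
Proof.
move=> hf hg; have [trif trig] := (in_class_triangle hf, in_class_triangle hg).
have [Y [h [u [v [d1 [tri1 [_ [_ [tri2 [_ gd1]]]]]]]]]] := triangle_ET4op trif trig.
exists Y, h, d1, u, v, (pull g' d); split; last first.
  exact: in_class_base_change hf tri2.
apply: xi_extension_in_class tri1; apply: (xi_extension_saturated hg).
by rewrite gd1; apply: xi_extension_push (in_class_xi_extension hf).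
Qed.

Lemma in_class_pushout (A B X B1 X1 : T) (x : mor A B) (y : mor B X) (d : EE X A)
    (x1 : mor A B1) (y1 : mor B1 X1) (d1 : EE X1 A) :
  in_class xi x y d -> in_class xi x1 y1 d1 ->
  exists (L : T) (m : mor B1 L) (e : mor L X) (m1 : mor B L) (e1 : mor L X1),
    in_class xi m e (push x1 d) /\ in_class xi m1 e1 (push x d1).
Proof.
move=> h h1.
have [L [m [e [m1 [e1 [tri tri1]]]]]] :=
  triangle_pushout (in_class_triangle h) (in_class_triangle h1).
exists L, m, e, m1, e1.
by split; [apply: in_class_cobase_change h tri | apply: in_class_cobase_change h1 tri1].
Qed.

Lemma in_class_pullback (A B X A1 B1 : T) (x : mor A B) (y : mor B X) (d : EE X A)
    (x1 : mor A1 B1) (y1 : mor B1 X) (d1 : EE X A1) :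
  in_class xi x y d -> in_class xi x1 y1 d1 ->
  exists (L : T) (m : mor A L) (e : mor L B1) (m1 : mor A1 L) (e1 : mor L B),
    in_class xi m e (pull y1 d) /\ in_class xi m1 e1 (pull y d1).
Proof.
move=> h h1.
have [L [m [e [m1 [e1 [tri tri1]]]]]] :=
  triangle_pullback (in_class_triangle h) (in_class_triangle h1).
exists L, m, e, m1, e1.
by split; [apply: in_class_base_change h tri | apply: in_class_base_change h1 tri1].
Qed.

(** Lets either summand of a split triangle play the role of the quotient. *)
Lemma in_class_split_swap (A B X : T) (x : mor A B) (y : mor B X) :
  in_class xi x y (0 : EE X A) ->
  exists (s : mor X B) (r : mor B A),
    [/\ in_class xi s r (0 : EE A X), r ∘ x = idmor A, y ∘ s = idmor X &
      x ∘ r + s ∘ y = idmor B].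
Proof.
move=> /in_class_triangle tri.
have [r /esym rx] := push_eq0_extend tri (a := idmor A) (push0 _ _ _).
have [s [tris ys xrsy]] := split_triangle_of_retraction tri rx.
by exists s, r; split=> //; apply: in_class_split.
Qed.

(** * Relative projectives and QP-acyclic objects *)

Lemma xi_projective_lift (P A B X : T) (x : mor A B) (y : mor B X) (d : EE X A)
    (w : mor P X) :
  xi_projective xi P -> in_class xi x y d -> exists v, y ∘ v = w.
Proof. by move=> projP h; have [_ _] := projP _ _ _ _ _ _ h; apply. Qed.

Lemma xi_extension_of_projective (P A : T) (d : EE P A) :
  xi_projective xi P -> xi_extension d -> d = 0.
Proof.
move=> projP [B [x [y h]]]; have [s ys] := xi_projective_lift (idmor P) projP h.
exact: (triangle_section (in_class_triangle h) ys).
Qed.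

Lemma xi_projective_biproduct (P1 P2 L : T) (i1 : mor P1 L) (r1 : mor L P1)
    (i2 : mor P2 L) (r2 : mor L P2) :
  i1 ∘ r1 + i2 ∘ r2 = idmor L ->
  xi_projective xi P1 -> xi_projective xi P2 -> xi_projective xi L.
Proof.
move=> id_sum proj1 proj2 A B X x y d h.
have tri := in_class_triangle h.
have decomp (W : T) (u : mor L W) : u = u ∘ i1 ∘ r1 + u ∘ i2 ∘ r2.
  by rewrite -!hcompA -hcompDr id_sum hcompm1.
split=> [u u' uu'|v|w].
- have [inj1 _ _] := proj1 _ _ _ _ _ _ h; have [inj2 _ _] := proj2 _ _ _ _ _ _ h.
  have e1 : u ∘ i1 = u' ∘ i1 by apply: inj1; rewrite /= !hcompA uu'.
  have e2 : u ∘ i2 = u' ∘ i2 by apply: inj2; rewrite /= !hcompA uu'.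
  by rewrite (decomp _ u) (decomp _ u') e1 e2.
- split=> [yv|[u <-]]; last by rewrite hcompA (triangle_comp0 tri) hcomp0m.
  by have [u ->] := triangle_ker tri yv; exists u.
have [v1 e1] := xi_projective_lift (w ∘ i1) proj1 h.
have [v2 e2] := xi_projective_lift (w ∘ i2) proj2 h.
by exists (v1 ∘ r1 + v2 ∘ r2); rewrite hcompDr !hcompA e1 e2 -decomp.
Qed.

Lemma xi_projective_zobj : xi_projective xi zobj.
Proof.
move=> A B X x y d h; split=> [u u' _|v|w]; first by rewrite [u]from_zobj [u']from_zobj.
  by split=> [_|_]; [exists 0; rewrite hcompm0 [v]from_zobj | apply: from_zobj].
by exists 0; rewrite hcompm0 [w]from_zobj.
Qed.

Lemma xi_projective_is_zero (A : T) : is_zero A -> xi_projective xi A.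
Proof.
case=> from0 _.
apply: (@xi_projective_biproduct zobj zobj A 0 0 0 0); try exact: xi_projective_zobj.
by rewrite [RHS]from0 [LHS]from0.
Qed.

Lemma xi_projective_extension (A B X : T) (x : mor A B) (y : mor B X) (d : EE X A) :
  in_class xi x y d -> xi_projective xi A -> xi_projective xi X -> xi_projective xi B.
Proof.
move=> h projA projX.
have d0 := xi_extension_of_projective projX (in_class_xi_extension h).
move: h; rewrite d0 => /in_class_split_swap [s [r [_ _ _ xrsy]]].
exact: xi_projective_biproduct xrsy projA projX.
Qed.

Lemma xi_projective_quasi (P : T) : xi_projective xi P -> quasi_xi_projective xi P.
Proof. by move=> projP A B x y d; apply: projP. Qed.

(** Equivalent to QP-exactness of every triangle of [xi] ending in [A], but in terms of
    which closure under extensions and retracts is easier to prove. *)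
Definition QP_acyclic (A : T) : Prop :=
  forall Q : T, quasi_xi_projective xi Q ->
    (forall (B K : T) (x : mor K B) (y : mor B A) (d : EE A K) (u : mor A Q),
       in_class xi x y d -> u ∘ y = 0 -> u = 0) /\
    (forall d : EE A Q, xi_extension d -> d = 0).

Lemma QP_acyclic_exact (A B X : T) (x : mor A B) (y : mor B X) (d : EE X A) :
  QP_acyclic X -> in_class xi x y d -> QP_exact xi x y.
Proof.
move=> acX h Q qpQ; have [inj ext0] := acX Q qpQ; have tri := in_class_triangle h.
split=> [u v uv|v|w].
- apply/eqP; rewrite -subr_eq0; apply/eqP; apply: inj h _.
  by rewrite hcompBm uv subrr.
- split=> [vx|[u <-]]; last by rewrite -hcompA (triangle_comp0 tri) hcompm0.
  by have [u ->] := triangle_coker tri vx; exists u.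
have [|b ->] := push_eq0_extend tri (a := w); last by exists b.
by apply: ext0; apply: xi_extension_push (in_class_xi_extension h).
Qed.

(** One triangle controls all others: [f] lifts through every deflation of [xi] onto [A], so every
    extension in [xi] is [push k d] for some [k], and [k] extends to [P] by exactness. *)
Lemma QP_exact_acyclic (K P A : T) (g : mor K P) (f : mor P A) (d : EE A K) :
  in_class xi g f d -> xi_projective xi P -> QP_exact xi g f -> QP_acyclic A.
Proof.
move=> h projP ex Q qpQ; have [inj _ surj] := ex Q qpQ; split.
  move=> B L x y e u hy uy; apply: inj; rewrite /= hcomp0m.
  by have [v <-] := xi_projective_lift f projP hy; rewrite hcompA uy hcomp0m.
move=> e [N [x [y hN]]].
have [v fv] := xi_projective_lift f projP hN.
have e1 : idmor A ∘ f = y ∘ v by rewrite hcomp1m.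
have [k [_ ke]] := triangle_ET3op (in_class_triangle h) (in_class_triangle hN) e1.
have [u uk] := surj k.
by rewrite -(pull1 e) -ke -uk push_comp (triangle_push0 (in_class_triangle h)) push0.
Qed.

Lemma QP_acyclic_projective (P : T) : xi_projective xi P -> QP_acyclic P.
Proof.
move=> projP Q qpQ; split=> [B K x y d u h uy|d]; last exact: xi_extension_of_projective.
have [s ys] := xi_projective_lift (idmor P) projP h.
by rewrite -(hcompm1 u) -ys hcompA uy hcomp0m.
Qed.

Lemma QP_acyclic_retract (A L : T) (i : mor A L) (r : mor L A) :
  r ∘ i = idmor A -> QP_acyclic L -> QP_acyclic A.
Proof.
move=> ri acL Q qpQ; have [inj ext0] := acL Q qpQ; split.
  move=> B K x y d u h uy.
  have [N [x' [y' hN]]] := xi_extension_pull r (in_class_xi_extension h).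
  have e : push (idmor K) (pull r d) = pull r d by rewrite push1.
  have [b [_ rb]] := triangle_lift (in_class_triangle hN) (in_class_triangle h) e.
  have ur : u ∘ r = 0.
    by apply: inj hN _; rewrite -hcompA rb hcompA uy hcomp0m.
  by rewrite -(hcompm1 u) -ri hcompA ur hcomp0m.
move=> d ext; rewrite -(pull1 d) -ri pull_comp (ext0 (pull r d)) ?pull0 //.
exact: xi_extension_pull.
Qed.

(** A map killed by a deflation onto [B] vanishes on [A], so it factors through [X], where the
    composite deflation kills it. An extension of [B] vanishes on [A], so it comes from [X], and
    saturation keeps its source in [xi]. *)
Lemma QP_acyclic_extension (A B X : T) (x : mor A B) (y : mor B X) (d : EE X A) :
  in_class xi x y d -> QP_acyclic A -> QP_acyclic X -> QP_acyclic B.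
Proof.
move=> h acA acX Q qpQ; have tri := in_class_triangle h.
have [injA extA] := acA Q qpQ; have [injX extX] := acX Q qpQ; split.
  move=> N K m e dN u hN ue.
  have ux : u ∘ x = 0.
    have [L [m' [e' hL]]] := xi_extension_pull x (in_class_xi_extension hN).
    have e1 : push (idmor K) (pull x dN) = pull x dN by rewrite push1.
    have [b [_ xb]] := triangle_lift (in_class_triangle hL) (in_class_triangle hN) e1.
    by apply: injA hL _; rewrite -hcompA xb hcompA ue hcomp0m.
  have [v uv] := triangle_coker tri ux.
  have [Y [p [d1 [_ [_ [_ [hY _]]]]]]] := in_class_comp_deflation hN h.
  by rewrite uv (injX _ _ _ _ _ v hY) ?hcomp0m // hcompA -uv.
move=> e ext.
(* Over [A] the triangle of [e] splits; pushing the extension [d2] from (ET4)op along the retraction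
   [r] of [k] gives [w]. *)
have [w we] : exists w, e = pull y w.
  have [N [m [p hN]]] := ext.
  have [Y [p' [k [q [d2 [_ [_ [_ [triY [_ yd2]]]]]]]]]] :=
    triangle_ET4op (in_class_triangle hN) tri.
  rewrite (extA _ (xi_extension_pull x ext)) in triY.
  have [r rk] := push_eq0_extend triY (a := idmor Q) (push0 _ _ _).
  by exists (push r d2); rewrite -push_pull yd2 -push_comp -rk push1.
rewrite we in ext *; rewrite (extX w) ?pull0 //.
exact: xi_extension_saturated h ext.
Qed.

End ProperClass.

(** * Closure properties of quasi-Gorenstein projective objects *)

Section QGP.
Set Implicit Arguments.
Unset Strict Implicit.
Import GRing.Theory.
Local Open Scope ring_scope.
Variables (T : extriCat) (xi : properClass T).

(** Carries data, so that a family of such triangles indexed by [int] can be chosen and spliced into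
    a complex. *)
Record syzygy_triangle (K A : T) := SyzygyTriangle {
  syzP : T;
  syzg : mor K syzP;
  syzf : mor syzP A;
  syzd : EE A K;
  syz_in_class : in_class xi syzg syzf syzd;
  syz_proj : xi_projective xi syzP
}.

Lemma QGP_left (A : T) : quasi_xi_Gorenstein_projective xi A ->
  [/\ QP_acyclic xi A, quasi_xi_Gorenstein_projective xi A &
    exists K : T, inhabited (syzygy_triangle K A) /\ quasi_xi_Gorenstein_projective xi K].
Proof.
move=> qgpA; have [X [R [projX exX [n An]]]] := qgpA; rewrite An in qgpA *.
split=> //; first exact: QP_exact_acyclic (rt_in_class R n) (projX n) (exX n).
exists (rtK R (n + 1)); split; last by exists X, R; split=> //; exists (n + 1).
by constructor; apply: SyzygyTriangle (rt_in_class R n) (projX n).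
Qed.

Lemma QGP_right (A : T) : quasi_xi_Gorenstein_projective xi A ->
  exists A' : T, inhabited (syzygy_triangle A A') /\ quasi_xi_Gorenstein_projective xi A'.
Proof.
move=> [X [R [projX exX [n ->]]]].
have -> : n = n - 1 + 1 by rewrite subrK.
exists (rtK R (n - 1)); split; last by exists X, R; split=> //; exists (n - 1).
by constructor; apply: SyzygyTriangle (rt_in_class R (n - 1)) (projX (n - 1)).
Qed.

(** Coinduction: the quasi-Gorenstein projective objects form the largest class of
    QP-acyclic objects having, within the class, a syzygy and a cosyzygy. *)
Lemma QGP_coind (S : T -> Prop) :
  (forall A, S A -> [/\ QP_acyclic xi A,
     exists K, inhabited (syzygy_triangle K A) /\ S K &
     exists A', inhabited (syzygy_triangle A A') /\ S A']) ->
  forall A, S A -> quasi_xi_Gorenstein_projective xi A.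
Proof.
move=> step A SA.
have left_ex (B : {B | S B}) :
    exists K : {K | S K}, inhabited (syzygy_triangle (sval K) (sval B)).
  by case: B => B SB; have [_ [K [h SK]] _] := step B SB; exists (exist _ K SK).
have right_ex (B : {B | S B}) :
    exists K : {K | S K}, inhabited (syzygy_triangle (sval B) (sval K)).
  by case: B => B SB; have [_ _ [K [h SK]]] := step B SB; exists (exist _ K SK).
have [l hl] := choice left_ex; have [r hr] := choice right_ex.
pose a := exist S A SA.
(* [Negz k] is [-(k+1)], whence [k.+1] cosyzygies. The step from -1 to 0 crosses the two branches
   and is checked separately. *)
pose K (n : int) := match n with Posz k => iter k l a | Negz k => iter k.+1 r a end.
have st n : inhabited (syzygy_triangle (sval (K (n + 1))) (sval (K n))).
  case: n => [k|[|k]] /=; first by rewrite addn1; apply: hl.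
    exact: (hr a).
  by rewrite subn1; apply: hr.
pose t n := inhabited_witness (st n).
pose d n := syzg (t n) ∘ syzf (t (n + 1)).
have dd n : d n ∘ d (n + 1) = 0.
  rewrite /d hcompA -(hcompA (syzg (t n))).
  rewrite (triangle_comp0 (in_class_triangle (syz_in_class (t (n + 1))))).
  by rewrite hcompm0 hcomp0m.
exists (Complex dd), (@ResolutionTriangles _ xi (Complex dd) (fun n => sval (K n))
  (fun n => syzg (t n)) (fun n => syzf (t n)) (fun n => syzd (t n))
  (fun n => syz_in_class (t n)) (fun n => erefl)).
split=> /= [n|n|]; first exact: syz_proj; last by exists 0.
apply: (QP_acyclic_exact _ (syz_in_class (t n))).
by have [] := step _ (svalP (K n)).
Qed.

(** Coinduction on the class of projectives, with [zobj] as both syzygy and cosyzygy. *)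
Lemma QGP_projective (P : T) :
  xi_projective xi P -> quasi_xi_Gorenstein_projective xi P.
Proof.
move: P; apply: QGP_coind => P projP; split; first exact: QP_acyclic_projective.
  exists zobj; split; last exact: xi_projective_zobj.
  constructor; apply: (SyzygyTriangle (in_class_split xi (triangle_split zobj P))).
  exact: xi_projective_biproduct (dsumE _ _) (@xi_projective_zobj _ xi) projP.
exists zobj; split; last exact: xi_projective_zobj.
constructor; apply: (SyzygyTriangle (in_class_split xi (triangle_split P zobj))).
exact: xi_projective_biproduct (dsumE _ _) projP (@xi_projective_zobj _ xi).
Qed.

Lemma QGP_zero (A : T) : is_zero A -> quasi_xi_Gorenstein_projective xi A.
Proof. by move/(@xi_projective_is_zero _ xi)/QGP_projective. Qed.

(** Coinduction on the class of such extensions. A horseshoe argument through pullbacks makes a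
    syzygy of [B] an extension of syzygies of [X] and [A]; pushouts do the same for cosyzygies. *)
Lemma QGP_extension (A B X : T) (x : mor A B) (y : mor B X) (d : EE X A) :
  in_class xi x y d -> quasi_xi_Gorenstein_projective xi A ->
  quasi_xi_Gorenstein_projective xi X -> quasi_xi_Gorenstein_projective xi B.
Proof.
move=> h qgpA qgpX.
pose S B := exists (A X : T) (x : mor A B) (y : mor B X) (d : EE X A),
  [/\ in_class xi x y d, quasi_xi_Gorenstein_projective xi A
    & quasi_xi_Gorenstein_projective xi X].
apply: (@QGP_coind S); last by exists A, X, x, y, d.
move=> {}B [{h qgpA qgpX}A [{}X [{}x [{}y [{}d [h qgpA qgpX]]]]]].
have [acA _ [K [[[P g f e hK projP]] qgpK]]] := QGP_left qgpA.
have [acX _ [K' [[[P' g' f' e' hK' projP']] qgpK']]] := QGP_left qgpX.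
have [A1 [[[Q i p c hA1 projQ]] qgpA1]] := QGP_right qgpA.
have [X1 [[[Q' i' p' c' hX1 projQ']] qgpX1]] := QGP_right qgpX.
split; first exact: QP_acyclic_extension h acA acX.
- have [L [m [u [m1 [u1 [hL hL1]]]]]] := in_class_pullback h hK'.
  have ext0 := xi_extension_of_projective projP' (in_class_xi_extension hL).
  rewrite ext0 in hL; have [s [r [hr _ _ _]]] := in_class_split_swap hL.
  have [L2 [m2 [u2 [m3 [u3 [hL2 hL3]]]]]] := in_class_pullback hr hK.
  have projL2 := xi_projective_extension hL2 projP' projP.
  have [Y [k [d1 [v [w [d2 [hY hKY]]]]]]] := in_class_comp_deflation hL3 hL1.
  exists Y; split; last by exists K, K', v, w, d2.
  by constructor; apply: SyzygyTriangle hY projL2.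
have [L [m [u [m1 [u1 [hL hL1]]]]]] := in_class_pushout h hA1.
(* On the cosyzygy side the splitting comes from the acyclicity of [X], as [Q] is
   quasi-projective. *)
have [_ /(_ _ (in_class_xi_extension hL)) ext0] := acX Q (xi_projective_quasi projQ).
rewrite ext0 in hL; have [s [r [hr _ _ _]]] := in_class_split_swap hL.
have [L2 [m2 [u2 [m3 [u3 [hL2 hL3]]]]]] := in_class_pushout hr hX1.
have projL2 := xi_projective_extension hL2 projQ' projQ.
have [Y [k [d1 [v [w [d2 [hY hKY]]]]]]] := in_class_comp_inflation hL1 hL3.
exists Y; split; last by exists A1, X1, v, w, d2.
by constructor; apply: SyzygyTriangle hY projL2.
Qed.

(** Coinduction on the whole class with the single object [A] adjoined. *)
Lemma QGP_intro (A K A' : T) :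
  QP_acyclic xi A -> inhabited (syzygy_triangle K A) -> inhabited (syzygy_triangle A A') ->
  quasi_xi_Gorenstein_projective xi K -> quasi_xi_Gorenstein_projective xi A' ->
  quasi_xi_Gorenstein_projective xi A.
Proof.
move=> acA tK tA' qgpK qgpA'.
pose S B := quasi_xi_Gorenstein_projective xi B \/ B = A.
apply: (@QGP_coind S); last by right.
move=> B [qgpB|->].
  have [acB _ [L [tL qgpL]]] := QGP_left qgpB; have [B' [tB' qgpB']] := QGP_right qgpB.
  by split=> //; [exists L | exists B']; split=> //; left.
by split=> //; [exists K | exists A']; split=> //; left.
Qed.

(** Composing a syzygy triangle of [L] with the projection to [K], and the inclusion of [K] with a
    cosyzygy triangle of [L], changes the outer terms only by extensions with [P]. *)
Lemma QGP_split_kernel (K L P : T) (x : mor K L) (y : mor L P) :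
  in_class xi x y (0 : EE P K) -> xi_projective xi P ->
  quasi_xi_Gorenstein_projective xi L -> quasi_xi_Gorenstein_projective xi K.
Proof.
move=> h projP qgpL.
have [s [r [hr rx _ _]]] := in_class_split_swap h.
have [acL _ [N [[[P0 g f e hN projP0]] qgpN]]] := QGP_left qgpL.
have [L1 [[[Q i p c hL1 projQ]] qgpL1]] := QGP_right qgpL.
have [Y [k [d1 [v [w [d2 [hY hNY]]]]]]] := in_class_comp_deflation hN hr.
have [Z [k' [d3 [v' [w' [d4 [hZ hPZ]]]]]]] := in_class_comp_inflation h hL1.
apply: (@QGP_intro K Y Z).
- exact: QP_acyclic_retract rx acL.
- by constructor; apply: SyzygyTriangle hY projP0.
- by constructor; apply: SyzygyTriangle hZ projQ.
- exact: QGP_extension hNY qgpN (QGP_projective projP).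
- exact: QGP_extension hPZ (QGP_projective projP) qgpL1.
Qed.

(** Schanuel's argument: pulling back against a known syzygy triangle of [A] makes [K] a complement
    of [P0] in an extension of [P] by [N]. *)
Lemma QGP_syzygy (K P A : T) (x : mor K P) (y : mor P A) (d : EE A K) :
  in_class xi x y d -> xi_projective xi P ->
  quasi_xi_Gorenstein_projective xi A -> quasi_xi_Gorenstein_projective xi K.
Proof.
move=> h projP qgpA.
have [_ _ [N [[[P0 g f e hN projP0]] qgpN]]] := QGP_left qgpA.
have [L [m [u [m1 [u1 [hL hL1]]]]]] := in_class_pullback h hN.
have ext0 := xi_extension_of_projective projP0 (in_class_xi_extension hL).
rewrite ext0 in hL; apply: (QGP_split_kernel hL projP0).
exact: QGP_extension hL1 qgpN (QGP_projective projP).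
Qed.

(** Embedding [L] in a projective makes [K] a syzygy of an extension of [L1] by [A]. *)
Lemma QGP_kernel (K L A : T) (x : mor K L) (y : mor L A) (d : EE A K) :
  in_class xi x y d -> quasi_xi_Gorenstein_projective xi L ->
  quasi_xi_Gorenstein_projective xi A -> quasi_xi_Gorenstein_projective xi K.
Proof.
move=> h qgpL qgpA.
have [L1 [[[Q i p c hL1 projQ]] qgpL1]] := QGP_right qgpL.
have [Z [k [d1 [v [w [d2 [hZ hAZ]]]]]]] := in_class_comp_inflation h hL1.
exact: QGP_syzygy hZ projQ (QGP_extension hAZ qgpA qgpL1).
Qed.

(** * Dimension, approximations and bounded resolutions *)

Lemma QGpd_le0 (A : T) : QGpd_le xi 0 A <-> quasi_xi_Gorenstein_projective xi A.
Proof. by split=> [[/QGP_zero|]|] //; right. Qed.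

Lemma QGpd_le_kernel (n : nat) (K L A : T) (x : mor K L) (y : mor L A) (d : EE A K) :
  in_class xi x y d -> QGpd_le xi n L -> quasi_xi_Gorenstein_projective xi A ->
  QGpd_le xi n K.
Proof.
case: n => [|n] h; first by move=> /QGpd_le0 qgpL qgpA; apply/QGpd_le0; apply: QGP_kernel h _ _.
move=> [N [G [g [f [e [hN qgpG leN]]]]]] qgpA.
have [Y [k [d1 [v [w [d2 [hY hNY]]]]]]] := in_class_comp_deflation hN h.
by exists N, Y, v, w, d2; split=> //; apply: QGP_kernel hY _ _.
Qed.

Lemma QGpd_le_split_extension (n : nat) (K L P : T) (x : mor K L) (y : mor L P) :
  in_class xi x y (0 : EE P K) -> xi_projective xi P -> QGpd_le xi n K -> QGpd_le xi n L.
Proof.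
case: n => [|n] h projP.
  by move=> /QGpd_le0 qgpK; apply/QGpd_le0; apply: QGP_extension h qgpK (QGP_projective projP).
move=> [N [G [g [f [e [hN qgpG leN]]]]]].
have [s [r [hr _ _ _]]] := in_class_split_swap h.
have [Y [m [u [m1 [u1 [hY hY1]]]]]] := in_class_pullback hr hN.
exists N, Y, m1, u1, (pull r e); split=> //.
exact: QGP_extension hY (QGP_projective projP) qgpG.
Qed.

(** In the pullback of the two presentations of [A], the middle term [L] is a split extension of [P]
    by [N], and [K] is the kernel of [L -> G]. *)
Lemma QGpd_le_syzygy (n : nat) (K P A : T) (x : mor K P) (y : mor P A) (d : EE A K) :
  in_class xi x y d -> xi_projective xi P -> QGpd_le xi n.+1 A -> QGpd_le xi n K.
Proof.
move=> h projP [N [G [g [f [e [hN qgpG leN]]]]]].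
have [L [m [u [m1 [u1 [hL hL1]]]]]] := in_class_pullback h hN.
have ext0 := xi_extension_of_projective projP (in_class_xi_extension hL1).
rewrite ext0 in hL1; apply: QGpd_le_kernel hL _ qgpG.
exact: QGpd_le_split_extension hL1 projP leN.
Qed.

Fixpoint proj_dim_le (n : nat) (A : T) : Prop :=
  match n with
  | 0 => xi_projective xi A
  | m.+1 => exists (K P : T) (x : mor K P) (y : mor P A) (d : EE A K),
      [/\ in_class xi x y d, xi_projective xi P & proj_dim_le m K]
  end.

(** Pushing the presentation of [A] out along a hull of its kernel. Isolated because hulls and
    approximations are built alternately. *)
Lemma QGP_approximation_of_hull (n : nat) (A : T) :
  (forall K, QGpd_le xi n K -> exists (Z G : T) (x : mor K Z) (y : mor Z G) (d : EE G K),
     [/\ in_class xi x y d, proj_dim_le n Z & quasi_xi_Gorenstein_projective xi G]) ->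
  QGpd_le xi n.+1 A ->
  exists (Z G : T) (x : mor Z G) (y : mor G A) (d : EE A Z),
    [/\ in_class xi x y d, quasi_xi_Gorenstein_projective xi G & proj_dim_le n Z].
Proof.
move=> hull [K [G [x [y [d [h qgpG leK]]]]]].
have [Z [G' [x' [y' [d' [h' pdZ qgpG']]]]]] := hull K leK.
have [L [m [u [m1 [u1 [hL hL1]]]]]] := in_class_pushout h h'.
exists Z, L, m, u, (push x' d); split=> //.
exact: QGP_extension hL1 qgpG qgpG'.
Qed.

(** Embedding the approximating object [G] in a projective [P] gives a hull [Y], the cokernel of
    [Z -> P], with one more projective step than [Z]. *)
Lemma QGpd_le_hull (n : nat) (K : T) : QGpd_le xi n K ->
  exists (Z G : T) (x : mor K Z) (y : mor Z G) (d : EE G K),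
    [/\ in_class xi x y d, proj_dim_le n Z & quasi_xi_Gorenstein_projective xi G].
Proof.
elim: n K => [|n IHn] K.
  move=> /QGpd_le0 /QGP_right [G [[[P x y d h projP]] qgpG]].
  by exists P, G, x, y, d.
move=> /(QGP_approximation_of_hull IHn) [Z [G [x [y [d [h qgpG pdZ]]]]]].
have [G' [[[P x' y' d' h' projP]] qgpG']] := QGP_right qgpG.
have [Y [k [d1 [v [w [d2 [hY hYG]]]]]]] := in_class_comp_inflation h h'.
exists Y, G', v, w, d2; split=> //.
by exists Z, P, (x' ∘ x), k, d1.
Qed.

Lemma QGP_approximation (n : nat) (A : T) : QGpd_le xi n.+1 A ->
  exists (Z G : T) (x : mor Z G) (y : mor G A) (d : EE A Z),
    [/\ in_class xi x y d, quasi_xi_Gorenstein_projective xi G & proj_dim_le n Z].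
Proof. exact: QGP_approximation_of_hull (@QGpd_le_hull n). Qed.

Lemma bounded_xi_exact0 (A : T) : bounded_xi_exact xi 0 (fun=> A) A.
Proof. by exists (fun=> A). Qed.

Lemma bounded_xi_exactS (n : nat) (G : nat -> T) (K B A : T)
    (x : mor K B) (y : mor B A) (d : EE A K) :
  in_class xi x y d -> bounded_xi_exact xi n G K ->
  bounded_xi_exact xi n.+1 (fun j => if j is i.+1 then G i else B) A.
Proof.
move=> h [L [L0 Ln tri]]; exists (fun j => if j is i.+1 then L i else A); split=> //.
case=> [_|j ltjn]; last exact: tri.
by move: (L 0%N) L0 => K' ->; exists x, y, d.
Qed.

Lemma proj_dim_le_exact (n : nat) (A : T) : proj_dim_le n A ->
  exists G : nat -> T, bounded_xi_exact xi n G A /\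
    forall j, (j <= n)%N -> xi_projective xi (G j).
Proof.
elim: n A => [|n IHn] A.
  by move=> projA; exists (fun=> A); split=> //; apply: bounded_xi_exact0.
move=> [K [P [x [y [d [h projP /IHn [G [exG projG]]]]]]]].
eexists; split; first exact: bounded_xi_exactS h exG.
by case=> // j; apply: projG.
Qed.

(** The approximation settles position 0; for a later position, a projective term is split off and
    the position drops by one. *)
Lemma QGpd_le_exact (n i : nat) (A : T) : enough_xi_projectives xi -> (i <= n)%N ->
  QGpd_le xi n A ->
  exists G : nat -> T, [/\ bounded_xi_exact xi n G A,
    quasi_xi_Gorenstein_projective xi (G i) &
    forall j, (j <= n)%N -> j <> i -> xi_projective xi (G j)].
Proof.
move=> enough; elim: n i A => [|n IHn] i A.
  case: i => // _ /QGpd_le0 qgpA; exists (fun=> A); split=> //; last by case.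
  exact: bounded_xi_exact0.
case: i => [_|i lein] leA.
  have [Z [G0 [x [y [d [h qgpG0 /proj_dim_le_exact [G [exG projG]]]]]]]] :=
    QGP_approximation leA.
  eexists; split; [exact: bounded_xi_exactS h exG | exact: qgpG0 |].
  by case=> // j lejn _; apply: projG.
have [K [P [x [y [d [h projP]]]]]] := enough A.
have [G [exG qgpG projG]] := IHn i K lein (QGpd_le_syzygy h projP leA).
eexists; split; [exact: bounded_xi_exactS h exG | exact: qgpG |].
by case=> // j lejn neji; apply: projG => // eji; apply: neji; rewrite eji.
Qed.

Lemma exact_QGpd_le (n : nat) (G : nat -> T) (A : T) :
  bounded_xi_exact xi n G A ->
  (forall j, (j <= n)%N -> quasi_xi_Gorenstein_projective xi (G j)) -> QGpd_le xi n A.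
Proof.
elim: n G A => [|n IHn] G A [K [K0 Kn tri]] qgpG.
  by apply/QGpd_le0; rewrite -K0 Kn; apply: qgpG.
have [g [f [d h]]] := tri 0%N isT.
rewrite K0 in f d h; exists (K 1%N), (G 0%N), g, f, d; split=> //; first exact: qgpG.
apply: (IHn (fun j => G j.+1)); last by move=> j; apply: (qgpG j.+1).
by exists (fun j => K j.+1); split=> // j; apply: (tri j.+1).
Qed.

(** * Cohomology and descent along a resolution *)

Variables (A : T) (P : proj_resolution xi A).

Lemma trivial_xxtP (B : T) (n : nat) :
  trivial_group (xxt P B n) <->
  forall u : mor (resP P n) B, u ∘ res_diff P n = 0 -> is_coboundary u.
Proof.
pose J := GRing.ZmodClosed.clone _ (coboundary (P := P) (B := B) (n := n)) _.
split=> [trivial u u0|cob v].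
  have hu : u \in cocycle (P := P) (B := B) (n := n) by rewrite unfold_in; apply/eqP.
  have : Cocycles hu - 0 \in J.
    by rewrite Quotient.idealrBE; apply/eqP; rewrite [LHS]trivial [RHS]trivial.
  by rewrite subr0 unfold_in => /asboolP.
rewrite -[v]reprK -[RHS]reprK; apply/eqP; rewrite -(Quotient.idealrBE J).
rewrite unfold_in; apply/asboolP/cob.
by case: (_ - _) => w /=; rewrite unfold_in => /eqP.
Qed.

Lemma QGpd_le_resK (n k : nat) : QGpd_le xi (n + k) A -> QGpd_le xi n (resK P k).
Proof.
elim: k n => [|k IHk] n; first by rewrite addn0 resK0.
by rewrite addnS -addSn => /IHk; apply: QGpd_le_syzygy (res_in_class P k) (res_proj P k).
Qed.

Lemma QGP_resK_addn (n k : nat) : quasi_xi_Gorenstein_projective xi (resK P n) ->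
  quasi_xi_Gorenstein_projective xi (resK P (n + k)).
Proof.
move=> qgp; elim: k => [|k IHk]; first by rewrite addn0.
by rewrite addnS; apply: QGP_syzygy (res_in_class P _) (res_proj P _) IHk.
Qed.

Lemma resK_QGpd_le (n k : nat) :
  quasi_xi_Gorenstein_projective xi (resK P (k + n)) -> QGpd_le xi n (resK P k).
Proof.
elim: n k => [|n IHn] k; first by rewrite addn0 => /QGpd_le0.
rewrite addnS -addSn => /IHn le.
exists (resK P k.+1), (resP P k), (resg P k), (resf P k), (resd P k).
by split=> //; [apply: res_in_class | apply/QGP_projective/res_proj].
Qed.

(** Acyclicity cancels the deflation onto [resK P n.+1], so [u] already vanishes on that syzygy. *)
Lemma cocycle_res_factor (n : nat) (Q : T) (u : mor (resP P n) Q) :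
  quasi_xi_projective xi Q -> QP_acyclic xi (resK P n.+1) ->
  u ∘ res_diff P n = 0 -> exists w, u = w ∘ resf P n.
Proof.
move=> qpQ /(_ Q qpQ) [inj _]; rewrite /res_diff hcompA => u0.
apply: (triangle_coker (in_class_triangle (res_in_class P n))).
exact: inj (res_in_class P n.+1) u0.
Qed.

Lemma QGP_resK_xxt (n m : nat) (Q : T) :
  quasi_xi_Gorenstein_projective xi (resK P n) -> quasi_xi_projective xi Q ->
  (n < m)%N -> trivial_group (xxt P Q m).
Proof.
move=> qgp qpQ ltnm; apply/trivial_xxtP; case: m ltnm => // m lenm u u0.
have acyclic k : (n <= k)%N -> QP_acyclic xi (resK P k).
  by move=> /subnKC <-; have [] := QGP_left (QGP_resK_addn (k - n) qgp).
have [w uw] := cocycle_res_factor qpQ (acyclic _ (leqW (leqW lenm))) u0.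
(* The degree is now [m.+1], so [w] lives on [resK P m.+1]; exactness of the triangle ending in
   [resK P m] extends it to [resP P m]. *)
have [_ _ surj] := QP_acyclic_exact (acyclic _ lenm) (res_in_class P m) qpQ.
by have [v vw] := surj w; exists v; rewrite uw -vw /res_diff hcompA.
Qed.

(* The cosyzygy inclusion of the next syzygy into a projective [Q0] extends to the
   resolution because of the vanishing cohomology, so pushing out along it
   exhibits [resK P j] as the complement of [Q0] in a quasi-Gorenstein projective. *)
Lemma xxt_QGP_resK (j : nat) :
  quasi_xi_Gorenstein_projective xi (resK P j.+1) ->
  (forall Q, quasi_xi_projective xi Q -> trivial_group (xxt P Q j.+1)) ->
  quasi_xi_Gorenstein_projective xi (resK P j).
Proof.
move=> qgpK vanish.
have [G [[[Q0 a c d hG projQ0]] qgpG]] := QGP_right qgpK.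
have qpQ0 := xi_projective_quasi projQ0.
have tri n := in_class_triangle (res_in_class P n).
have [|v] := (trivial_xxtP Q0 j.+1).1 (vanish _ qpQ0) (a ∘ resf P j.+1).
  by rewrite /res_diff hcompA -(hcompA a) (triangle_comp0 (tri _)) hcompm0 hcomp0m.
rewrite /res_diff hcompA => av.
have [acK _ _] := QGP_left qgpK; have [inj _ _] := QP_acyclic_exact acK (res_in_class P j.+1) qpQ0.
have {}av : a = v ∘ resg P j by apply: inj.
have [L [m [e [m1 [e1 [hL hL1]]]]]] := in_class_pushout (res_in_class P j) hG.
have pushP : push a (resd P j) = 0 by rewrite av push_comp (triangle_push0 (tri j)) push0.
rewrite pushP in hL; have [s [r [hs _ _ _]]] := in_class_split_swap hL.
apply: QGP_split_kernel hs projQ0 _.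
exact: QGP_extension hL1 (QGP_projective (res_proj P j)) qgpG.
Qed.

(** Finite dimension makes syzygy [n + k] quasi-Gorenstein projective; vanishing in degrees above
    [n] descends this to syzygy [n]. *)
Lemma QGpd_le_xxt (n : nat) : (exists m, QGpd_le xi m A) ->
  QGpd_le xi n A <->
  forall (m : nat) (Q : T), (n < m)%N -> quasi_xi_projective xi Q ->
    trivial_group (xxt P Q m).
Proof.
move=> [k lek]; split=> [len m Q ltnm qpQ|vanish].
  by apply: (QGP_resK_xxt _ qpQ ltnm); apply/QGpd_le0/QGpd_le_resK.
rewrite -(resK0 P); apply: resK_QGpd_le; rewrite add0n.
have : quasi_xi_Gorenstein_projective xi (resK P (n + k)).
  by rewrite addnC; apply/QGP_resK_addn/QGpd_le0/QGpd_le_resK.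
elim: k {lek} => [|k IHk]; first by rewrite addn0.
rewrite addnS => qgp; apply/IHk/(xxt_QGP_resK qgp) => Q; apply: vanish.
by rewrite ltnS leq_addr.
Qed.

(** Degree 0 needs its own argument: a cocycle there factors through the zero object [A]. *)
Lemma zero_xxt (m : nat) (Q : T) : is_zero A -> quasi_xi_projective xi Q ->
  trivial_group (xxt P Q m).
Proof.
move=> zeroA qpQ.
have qgp : quasi_xi_Gorenstein_projective xi (resK P 0) by rewrite resK0; apply: QGP_zero.
case: m => [|m]; last exact: QGP_resK_xxt qgp qpQ _.
have [ac1 _ _] := QGP_left (QGP_resK_addn 1 qgp).
apply/trivial_xxtP => u /(cocycle_res_factor qpQ ac1) [w ->] /=.
by move: (resf P 0) w; rewrite resK0 => f w; rewrite [w](zeroA.1 Q) hcomp0m.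
Qed.

End QGP.

(** Cohomology is computed from an arbitrary resolution [P]. Zero objects are treated apart in the
    dimension formula: their dimension is -1 and no degree has nonzero cohomology. *)
Theorem theorem5p3 (T : extriCat) (wic : WIC T) (xi : properClass T)
    (enough_proj : enough_xi_projectives xi) (enough_inj : enough_xi_injectives xi)
    (M : T) (finite_dim : exists m : nat, QGpd_le xi m M)
    (P : proj_resolution xi M) (n : nat) (n_gt0 : (0 < n)%N) :
  let nonvanishing (m : nat) : Prop :=
    exists Q : T, quasi_xi_projective xi Q /\ ~ trivial_group (xxt P Q m) in
  (QGpd_le xi n M <->
     forall (i : nat) (Q : T), (1 <= i)%N -> quasi_xi_projective xi Q ->
       trivial_group (xxt P Q (n + i)))
  /\
  (QGpd_le xi n M <->
     forall i : nat, (i <= n)%N ->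
       exists G : nat -> T,
         bounded_xi_exact xi n G M /\
         quasi_xi_Gorenstein_projective xi (G i) /\
         forall j : nat, (j <= n)%N -> j <> i -> xi_projective xi (G j))
  /\
  (~ is_zero M ->
     exists d : option nat, QGpd_eq xi M (omap Posz d) /\ is_sup nonvanishing d)
  /\
  (is_zero M -> QGpd_eq xi M (Some (-1)%R) /\ forall m : nat, ~ nonvanishing m).
Proof.
move=> nonvanishing; split; [|split; [|split]].
- split=> [/(QGpd_le_xxt P n finite_dim) vanish i Q i_gt0|vanish].
    by apply: vanish; rewrite -[X in (X < _)%N]addn0 ltn_add2l.
  apply/(QGpd_le_xxt P n finite_dim) => m Q ltnm qpQ.
  by rewrite -(subnKC (ltnW ltnm)); apply: vanish => //; rewrite subn_gt0.
- split=> [len i lein|exG].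
    by have [G [exG qgpG projG]] := QGpd_le_exact enough_proj lein len; exists G.
  have [G [exGn [qgpG projG]]] := exG n (leqnn n).
  apply: exact_QGpd_le exGn _ => j lejn; have [->//|/eqP neji] := eqVneq j n.
  exact/QGP_projective/projG.
- move=> nonzeroM.
  have ex_dim : exists m, `[< QGpd_le xi m M >].
    by case: finite_dim => m lem; exists m; apply/asboolP.
  case: (ex_minnP ex_dim) => d /asboolP led min_d; exists (Some d); split.
    case: d led min_d => [[//|qgpM]|d led min_d] /=; first by [].
    by split=> // /asboolP/min_d; rewrite ltnn.
  split=> [m [Q [qpQ nontrivial]]|b ub].
    rewrite leqNgt; apply/negP => ltdm; apply: nontrivial.
    exact: (QGpd_le_xxt P d finite_dim).1 led m Q ltdm qpQ.
  (* An upper bound [b] of the nonvanishing degrees bounds the dimension as well, so minimality of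
     [d] gives [d <= b]. *)
  apply/min_d/asboolP/(QGpd_le_xxt P b finite_dim) => m Q ltbm qpQ.
  apply: contrapT => nontrivial.
  by have := ub m (ex_intro _ Q (conj qpQ nontrivial)); rewrite leqNgt ltbm.
move=> zeroM; split=> // m [Q [qpQ nontrivial]]; apply: nontrivial.
exact: zero_xxt.
Qed.
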